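(* Define $s(n)$ by $$\sum_{n=0}^{\infty}s(n)q^n=\sum_{n=0}^{\infty}\frac{(-1;q^2)_nq^{n(n+1)}}{(q;q)_{2n}}=\frac{(-q^2;q^2)_\infty}{(q^2;q^2)_\infty}(q^6,-q^3,-q^3;q^6)_\infty.$$ Then for all integers $\alpha\ge0$ and all $n\ge0$: (i) for every prime $p\ge5$ with $\left(\frac{-1}{p}\right)=-1$ and $1\le j\le p-1$, $$\sum_{n\ge0}s\!\left(24p^{2\alpha}n+5p^{2\alpha}\right)q^n\equiv4\ell_1\ell_4\pmod8,\qquad s\!\left(24p^{2\alpha+2}n+24p^{2\alpha+1}j+5p^{2\alpha+2}\right)\equiv0\pmod8;$$ (ii) for every prime $p\ge5$ with $\left(\frac{-2}{p}\right)=-1$ and $1\le j\le p-1$, $$\sum_{n\ge0}s\!\left(24p^{2\alpha}n+11p^{2\alpha}\right)q^n\equiv4\ell_2\psi(q^3)\pmod8,\qquad s\!\left(24p^{2\alpha+2}n+24p^{2\alpha+1}j+11p^{2\alpha+2}\right)\equiv0\pmod8;$$ (iii) for every prime $p\ge5$ with $\left(\frac{-6}{p}\right)=-1$ and $1\le j\le p-1$, $$\sum_{n\ge0}s\!\left(24p^{2\alpha}n+7p^{2\alpha}\right)q^n\equiv8\ell_1\psi(q^2)\pmod{16},\qquad s\!\left(24p^{2\alpha+2}n+24p^{2\alpha+1}j+7p^{2\alpha+2}\right)\equiv0\pmod{16};$$ (iv) for every prime $p\ge5$ with $\left(\frac{-18}{p}\right)=-1$ and $1\le j\le p-1$, $$\sum_{n\ge0}s\!\left(24p^{2\alpha}n+19p^{2\alpha}\right)q^n\equiv8\ell_1\psi(q^6)\pmod{16},\qquad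 s\!\left(24p^{2\alpha+2}n+24p^{2\alpha+1}j+19p^{2\alpha+2}\right)\equiv0\pmod{16}.$$
   Context: $(A;q)_0=1$, $(A;q)_n=\prod_{j=0}^{n-1}(1-Aq^j)$, $(A;q)_\infty=\prod_{j\ge0}(1-Aq^j)$, $(A_1,\dots,A_r;q)_\infty=\prod_i(A_i;q)_\infty$, and $\ell_n=(q^n;q^n)_\infty$. $\psi(q)=\sum_{m\ge0}q^{m(m+1)/2}=\ell_2^2/\ell_1$. A congruence between power series modulo $M$ means coefficientwise congruence modulo $M$. $\left(\frac{\cdot}{p}\right)$ is the Legendre symbol. *)

(* Defs.v *)
From mathcomp Require Import all_boot all_algebra.
Set Implicit Arguments. Unset Strict Implicit. Unset Printing Implicit Defensive.
Import GRing.Theory Num.Theory.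
Local Open Scope ring_scope.

Definition series := nat -> int.

Definition smul (f g : series) : series :=
  fun n => \sum_(0 <= i < n.+1) f i * g (n - i)%N.

Definition sone : series := fun n => if n == 0%N then 1 else 0.

Definition sprod (fs : seq series) : series := foldr smul sone fs.

Definition monom (c : int) (k : nat) : series :=
  fun n => if n == k then c else 0.

Definition factor (c : int) (k : nat) : series :=
  fun n => sone n - monom c k n.

(* 1/(1 - c q^k) = sum_m c^m q^(k m), for k >= 1 *)
Definition inv_factor (c : int) (k : nat) : series :=
  fun n => if (k %| n)%N then c ^+ (n %/ k)%N else 0.

Definition qpoch_fin (c : int) (a b m : nat) : series :=
  sprod [seq factor c (a + b * j)%N | j <- iota 0 m].

(* (c q^a ; q^b)_oo, for b >= 1: the coefficient of q^n only involves the
   factors with j <= n (the others are 1 mod q^(n+1)). *)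
Definition qpoch_inf (c : int) (a b : nat) : series :=
  fun n => qpoch_fin c a b n.+1 n.

(* 1 / (q^a ; q^b)_m  (all exponents >= 1 when a >= 1) *)
Definition inv_qpoch_fin (a b m : nat) : series :=
  sprod [seq inv_factor 1 (a + b * j)%N | j <- iota 0 m].

(* 1 / (q^a ; q^b)_oo for a, b >= 1 *)
Definition inv_qpoch_inf (a b : nat) : series :=
  fun n => inv_qpoch_fin a b n.+1 n.

Definition ell (k : nat) : series := qpoch_inf 1 k k.

Definition psi_at (k : nat) : series :=
  fun n => \sum_(0 <= m < n.+1) (if (k * (m * m.+1)./2 == n)%N then 1 else 0).

(* s(N): coefficient of q^N in sum_{n>=0} (-1;q^2)_n q^(n(n+1)) / (q;q)_(2n).
   Terms with n > N do not contribute to q^N. *)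
Definition s_term (n : nat) : series :=
  smul (qpoch_fin (-1) 0 2 n)
       (smul (monom 1 (n * n.+1)) (inv_qpoch_fin 1 1 (2 * n))).

Definition s (N : nat) : int := \sum_(0 <= n < N.+1) s_term n N.

Definition legendre (a : int) (p : nat) : int :=
  if (p%:Z %| a)%Z then 0
  else if [exists x : 'I_p, (p%:Z %| (x%:Z ^+ 2 - a))%Z] then 1 else -1.

Definition scong (f g : series) (M : int) : Prop :=
  forall n, (f n == g n %[mod M])%Z.

(* Main.v *)
(** With Q = q^2, t(n,r) = (-1;Q)_n Q^(n(n+1)/2) / ((Q;Q)_(n-r) (Q;Q)_(n+r)) and
    F_r = sum_n t(n,r), a telescoping certificate gives
    (1 + Q^(r+1)) F_(r+1) = Q^(r+1) (1 + Q^r) F_r, hence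
    (1 + Q^r) F_r = 2 Q^(r(r+1)/2) F_0.  Inserting the Bailey pair
    1/(q;q)_(2n) = sum_r q^(2r^2-r) / ((Q;Q)_(n-r) (Q;Q)_(n+r)) (Gauss), and the
    unit Bailey pair (finite Jacobi triple product at z = 1) to evaluate F_0,
    yields sum_n s(n) q^n = phi(q^3) / phi(-q^2), without infinite products.

    Write phi(-q^2) = 1 + 2A and phi(q^3) = 1 + 2B.  At the relevant exponents
    N, s(N) is congruent to 4 (AB)_N modulo 8 or to 8 (A^2 B)_N modulo 16, so
    only the parity of these coefficients matters.  Over F_2 the Jacobi triple
    product turns them into coefficients of ell_1 ell_4, ell_2 psi(q^3),
    ell_1 psi(q^2), ell_1 psi(q^6), which count modulo 2 the representations of
    N by x^2 + 4y^2, 2x^2 + 9y^2, x^2 + 6y^2, x^2 + 18y^2.  When p is inert,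
    p | N forces p | x and p | y: the count at p^2 N equals the count at N, and
    it vanishes at N if p divides N exactly once. *)
From HB Require Import structures.
Require Import Defs.
From mathcomp Require Import all_boot all_algebra.
From mathcomp Require Import boolp zify ring.
Import GRing.Theory Num.Theory.
Local Open Scope ring_scope.

Set Implicit Arguments. Unset Strict Implicit. Unset Printing Implicit Defensive.

(** * Formal power series *)

Definition fps (R : Type) : Type := nat -> R.

HB.instance Definition _ (R : Type) := gen_eqMixin (fps R).
HB.instance Definition _ (R : Type) := gen_choiceMixin (fps R).

Section FpsRing.
Variable R : comNzRingType.
Implicit Types f g h : fps R.

Definition fps0 : fps R := fun=> 0.
Definition fps1 : fps R := fun n => if n == 0%N then 1 else 0.
Definition fps_add f g : fps R := fun n => f n + g n.
Definition fps_opp f : fps R := fun n => - f n.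
Definition fps_mul f g : fps R := fun n => \sum_(0 <= i < n.+1) f i * g (n - i)%N.

Fact fps_addA : associative fps_add.
Proof. by move=> f g h; apply: funext => n; rewrite /fps_add addrA. Qed.
Fact fps_addC : commutative fps_add.
Proof. by move=> f g; apply: funext => n; rewrite /fps_add addrC. Qed.
Fact fps_add0 : left_id fps0 fps_add.
Proof. by move=> f; apply: funext => n; rewrite /fps_add add0r. Qed.
Fact fps_addN : left_inverse fps0 fps_opp fps_add.
Proof. by move=> f; apply: funext => n; rewrite /fps_add addNr. Qed.

HB.instance Definition _ :=
  GRing.isZmodule.Build (fps R) fps_addA fps_addC fps_add0 fps_addN.

Let trunc m f : {poly R} := \poly_(i < m) f i.

(** A coefficient of a product depends only on the factors up to that degree, so the ring axioms are
    inherited from polynomials. *)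
Let fps_mul_trunc m f g n : (n < m)%N -> fps_mul f g n = (trunc m f * trunc m g)`_n.
Proof.
move=> ltnm; rewrite coefM /fps_mul big_mkord; apply: eq_bigr => i _.
by rewrite !coef_poly !ifT ?(leq_ltn_trans _ ltnm) ?leq_subr // -ltnS.
Qed.

Fact fps_mulA : associative fps_mul.
Proof.
move=> f g h; apply: funext => n; rewrite !(@fps_mul_trunc n.+1) //.
transitivity ((trunc n.+1 f * (trunc n.+1 g * trunc n.+1 h))`_n).
  rewrite !(coefM (trunc _ f)); apply: eq_bigr => i _; congr (_ * _).
  by rewrite coef_poly ltnS leq_subr (@fps_mul_trunc n.+1) // ltnS leq_subr.
rewrite mulrA !(coefM _ (trunc _ h)); apply: eq_bigr => i _; congr (_ * _).
by rewrite coef_poly ltn_ord (@fps_mul_trunc n.+1).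
Qed.

Fact fps_mulC : commutative fps_mul.
Proof.
by move=> f g; apply: funext => n; rewrite !(@fps_mul_trunc n.+1) // mulrC.
Qed.

Fact fps_mul1 : left_id fps1 fps_mul.
Proof.
move=> f; apply: funext => n; rewrite /fps_mul big_nat_recl //= mul1r subn0.
by rewrite big1 ?addr0 // => i _; rewrite mul0r.
Qed.

Fact fps_mulDl : left_distributive fps_mul fps_add.
Proof.
move=> f g h; apply: funext => n; rewrite /fps_mul /fps_add -big_split /=.
by apply: eq_bigr => i _; rewrite mulrDl.
Qed.

Fact fps_oner_neq0 : fps1 != 0 :> fps R.
Proof.
by apply/eqP => /(congr1 (fun f : fps R => f 0%N))/eqP; rewrite /fps1 /= oner_eq0.
Qed.

HB.instance Definition _ := GRing.Zmodule_isComNzRing.Build (fps R)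
  fps_mulA fps_mulC fps_mul1 fps_mulDl fps_oner_neq0.

Lemma fpsE f g : f =1 g -> f = g.
Proof. exact: funext. Qed.

Lemma coef1E n : (1 : fps R) n = (n == 0%N)%:R.
Proof. by rewrite /GRing.one /= /fps1; case: eqP. Qed.
Lemma coefDE f g n : (f + g) n = f n + g n. Proof. by []. Qed.
Lemma coefNE f n : (- f) n = - f n. Proof. by []. Qed.
Lemma coefME f g n : (f * g) n = \sum_(0 <= i < n.+1) f i * g (n - i)%N.
Proof. by []. Qed.
Lemma coef_sumE I (r : seq I) (P : pred I) (F : I -> fps R) n :
  (\sum_(i <- r | P i) F i) n = \sum_(i <- r | P i) F i n.
Proof. by elim/big_rec2: _ => // i _ x Pi <-. Qed.
Lemma coefMnE f k n : (f *+ k) n = f n *+ k.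
Proof. by elim: k => [|k IHk]; rewrite ?mulr0n // !mulrS -IHk. Qed.

Definition qX : fps R := fun n => (n == 1%N)%:R.

Lemma coefXM f n : (qX * f) n = if n is n'.+1 then f n' else 0.
Proof.
rewrite coefME; case: n => [|n]; first by rewrite big_nat1 mul0r.
rewrite big_nat_recl // mul0r add0r big_nat_recl // subn1 mul1r big1 ?addr0 //.
by move=> i _; rewrite mul0r.
Qed.

Lemma coefXnM k f n : (qX ^+ k * f) n = if (k <= n)%N then f (n - k)%N else 0.
Proof.
elim: k n => [|k IHk] n; first by rewrite expr0 mul1r subn0.
by rewrite exprS -mulrA coefXM; case: n => [|n] //; rewrite IHk.
Qed.

Lemma coefXn k n : (qX ^+ k) n = (n == k)%:R.
Proof.
rewrite -[qX ^+ k]mulr1 coefXnM coef1E; case: leqP => ?; last by case: eqP => //; lia.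
by congr ((nat_of_bool _)%:R); lia.
Qed.

End FpsRing.

(** * Finite q-series identities *)

(** Pairs the terms of index r and -r of a bilateral sum, as Bailey pairs and the triple product
    require. *)
Lemma sum_centered (V : nmodType) (n : nat) (G : nat -> V) :
  \sum_(k < (2 * n).+1) G k
    = G n + \sum_(r < n) (G (n + r.+1)%N + G (n - r.+1)%N).
Proof.
rewrite -(big_mkord xpredT) (@big_cat_nat _ _ _ n) //=; last by lia.
rewrite (@big_ltn _ _ _ n) /=; last by lia.
rewrite addrCA; congr (_ + _); rewrite big_split /= addrC; congr (_ + _).
  rewrite -{1}[n.+1]add0n big_addn (_ : (2 * n).+1 - n.+1 = n)%N; last by lia.
  by rewrite big_mkord; apply: eq_bigr => i _; rewrite addnC addSnnS.
rewrite big_nat_rev /= big_mkord add0n.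
by apply: eq_bigr => i _; congr G; lia.
Qed.

Lemma bin2S (k : nat) : 'C(k.+1, 2) = (k + 'C(k, 2))%N.
Proof. by rewrite binS bin1 addnC. Qed.

Lemma mul2bin2 (k : nat) : (2 * 'C(k, 2) = k * k.-1)%N.
Proof. by elim: k => [|k IHk]; rewrite ?bin2S //; nia. Qed.

(* [c2 x] is the binomial coefficient x(x-1)/2 at an arbitrary integer x. *)
Definition c2 (x : int) : nat := `|x * (x - 1)|./2.

Lemma mul2c2 (x : int) : 2 * (c2 x)%:Z = x * (x - 1).
Proof.
have ge0 : 0 <= x * (x - 1) by nia.
have ev : ~~ odd `|x * (x - 1)|.
  rewrite abszM oddM; apply/nandP; case: (boolP (odd `|x|)) => ?; [right|left] => //.
  by lia.
have := even_halfK ev; rewrite /c2; lia.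
Qed.

Section QFactorials.
Variables (V : comNzRingType) (Q : V) (E : nat -> V).
Hypothesis E0 : E 0%N = 1.
Hypothesis ES : forall n, E n = E n.+1 * (1 - Q ^+ n.+1).

Definition qfact (n : nat) : V := \prod_(j < n) (1 - Q ^+ j.+1).

Lemma qfactS n : qfact n.+1 = qfact n * (1 - Q ^+ n.+1).
Proof. by rewrite /qfact big_ord_recr. Qed.

(** The hypotheses on [E] make [E n] the inverse of (Q;Q)_n, so no division is ever needed. *)
Lemma mul_qfactE n : qfact n * E n = 1.
Proof.
elim: n => [|n IHn]; first by rewrite /qfact big_ord0 mul1r.
by rewrite -IHn qfactS (ES n); ring.
Qed.

Definition qbin_sum (z w : V) (m : nat) : V :=
  \sum_(k < m.+1) (-1) ^+ k * Q ^+ 'C(k, 2) * z ^+ k * w ^+ (m - k) * (E k * E (m - k)).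

(** Splits 1 - Q^(m+1) as (1 - Q^(m+1-k)) + Q^(m+1-k) (1 - Q^k); each part cancels the last factor
    of one of the two denominators. *)
Lemma qbin_sumS z w m :
  (1 - Q ^+ m.+1) * qbin_sum z w m.+1 = (w - z * Q ^+ m) * qbin_sum z w m.
Proof.
rewrite {1}/qbin_sum mulr_sumr.
pose a k := (-1) ^+ k * Q ^+ 'C(k, 2) * z ^+ k * w ^+ (m.+1 - k)
  * (E k * (E (m.+1 - k) * (1 - Q ^+ (m.+1 - k)))).
pose b k := (-1) ^+ k * Q ^+ 'C(k, 2) * z ^+ k * w ^+ (m.+1 - k)
  * Q ^+ (m.+1 - k) * ((1 - Q ^+ k) * E k * E (m.+1 - k)).
rewrite (eq_bigr (fun k : 'I_m.+2 => a k + b k)); last first.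
  move=> k _; rewrite /a /b.
  have -> : Q ^+ m.+1 = Q ^+ (m.+1 - k) * Q ^+ k by rewrite -exprD subnK // -ltnS.
  ring.
rewrite big_split /= big_ord_recr /= {2}/a subnn subrr !mulr0 addr0.
rewrite [X in _ + X]big_ord_recl {1}/b /= subrr !(mul0r, mulr0) add0r.
rewrite mulrBl; congr (_ + _); rewrite ?mulNr mulr_sumr -?sumrN; apply: eq_bigr => k _.
  have kle : (k <= m)%N by rewrite -ltnS.
  by rewrite /a subSn // exprS -ES; ring.
rewrite /b /bump /= add1n subSS bin2S !exprS exprD.
have -> : Q ^+ m = Q ^+ (m - k) * Q ^+ k by rewrite -exprD subnK // -ltnS.
have -> : (1 - Q * Q ^+ k) * E k.+1 = E k by rewrite (ES k) exprS mulrC.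
ring.
Qed.

Theorem qbinomial z w m :
  qfact m * qbin_sum z w m = \prod_(j < m) (w - z * Q ^+ j).
Proof.
elim: m => [|m IHm].
  by rewrite /qfact /qbin_sum big_ord1 !big_ord0 /= E0 !mulr1.
by rewrite qfactS -mulrA qbin_sumS mulrCA IHm big_ord_recr mulrC.
Qed.

End QFactorials.

Section Gauss.
Variables (V : comNzRingType) (q : V) (E : nat -> V).
Hypothesis E0 : E 0%N = 1.
Hypothesis ES : forall n, E n = E n.+1 * (1 - (q ^+ 2) ^+ n.+1).

(** For m = 2n and k = n + r the exponent is 2r^2 - r. Odd m is included because the recurrence
    advances m by one. *)
Definition gauss_sum (m : nat) : V :=
  \sum_(k < m.+1) q ^+ c2 (2 * k%:Z - m%:Z) * (E k * E (m - k)).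

(** Here 1 - (q^2)^(m+1) is split as (1 - q^(2k)) + q^(2k) (1 - q^(2(m+1-k))); the two parts give
    the sum for m and q^(m+1) times it. *)
Lemma gauss_sumS m :
  (1 - (q ^+ 2) ^+ m.+1) * gauss_sum m.+1 = (1 + q ^+ m.+1) * gauss_sum m.
Proof.
rewrite {1}/gauss_sum mulr_sumr.
pose a k := q ^+ c2 (2 * k%:Z - m.+1%:Z) * ((1 - (q ^+ 2) ^+ k) * E k * E (m.+1 - k)).
pose b k := q ^+ c2 (2 * k%:Z - m.+1%:Z) * (q ^+ 2) ^+ k
  * (E k * (E (m.+1 - k) * (1 - (q ^+ 2) ^+ (m.+1 - k)))).
rewrite (eq_bigr (fun k : 'I_m.+2 => a k + b k)); last first.
  move=> k _; rewrite /a /b.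
  have -> : (q ^+ 2) ^+ m.+1 = (q ^+ 2) ^+ (m.+1 - k) * (q ^+ 2) ^+ k.
    by rewrite -[in RHS]exprD subnK // -ltnS.
  ring.
rewrite big_split /= [X in _ + X]big_ord_recr /= {2}/b subnn subrr !mulr0 addr0.
rewrite big_ord_recl {1}/a /= subrr !(mul0r, mulr0) add0r.
rewrite mulrDl mul1r; congr (_ + _); last first.
  rewrite mulr_sumr; apply: eq_bigr => k _.
  have kle : (k <= m)%N by rewrite -ltnS.
  rewrite /b subSn // -ES [in RHS]mulrA -!exprM -!exprD; congr (q ^+ _ * _).
  have := mul2c2 (2 * k%:Z - m.+1%:Z); have := mul2c2 (2 * k%:Z - m%:Z); nia.
(* The symmetry [c2 (1 - y) = c2 y] matches the exponents after k is replaced by m - k. *)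
rewrite /gauss_sum [RHS](reindex_inj rev_ord_inj) /=; apply: eq_bigr => k _.
have kle : (k <= m)%N by rewrite -ltnS.
rewrite /a /bump /= add1n !subSS subKn //.
have -> : (1 - (q ^+ 2) ^+ k.+1) * E k.+1 = E k by rewrite (ES k) mulrC.
rewrite [E k * _]mulrC; congr (q ^+ _ * _).
have := mul2c2 (2 * k.+1%:Z - m.+1%:Z); have := mul2c2 (2 * (m - k)%:Z - m%:Z); nia.
Qed.

Lemma gauss_sumE m :
  qfact (q ^+ 2) m * gauss_sum m = \prod_(j < m) (1 + q ^+ j.+1).
Proof.
elim: m => [|m IHm].
  by rewrite /qfact /gauss_sum big_ord1 !big_ord0 /= E0 !mulr1.
by rewrite qfactS -mulrA gauss_sumS mulrCA IHm big_ord_recr mulrC.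
Qed.

End Gauss.

(** * Bailey's lemma *)

Section Truncation.
Variable R : comNzRingType.
Implicit Types f g h : fps R.

(** Congruence modulo q^N. Infinite sums and products are compared through finite truncations, and
    [eqm_eq] passes to the limit. *)
Variant eqm (N : nat) f g : Prop := Eqm of forall i, (i < N)%N -> f i = g i.

Lemma eqm_coef N f g i : eqm N f g -> (i < N)%N -> f i = g i.
Proof. by case=> fg; apply: fg. Qed.
Lemma eqm_refl N f : eqm N f f. Proof. by []. Qed.
Lemma eqm_sym N f g : eqm N f g -> eqm N g f.
Proof. by case=> fg; split=> i /fg. Qed.
Lemma eqm_trans N g f h : eqm N f g -> eqm N g h -> eqm N f h.
Proof. by case=> fg [gh]; split=> i iN; rewrite fg ?gh. Qed.
Lemma eqmW M N f g : (N <= M)%N -> eqm M f g -> eqm N f g.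
Proof. by move=> le [fg]; split=> i iN; apply: fg; apply: leq_trans le. Qed.
Lemma eqmD N f f' g g' : eqm N f f' -> eqm N g g' -> eqm N (f + g) (f' + g').
Proof. by case=> ff [gg]; split=> i iN; rewrite !coefDE ff ?gg. Qed.
Lemma eqmM N f f' g g' : eqm N f f' -> eqm N g g' -> eqm N (f * g) (f' * g').
Proof.
case=> ff [gg]; split=> i iN; rewrite !coefME !big_mkord; apply: eq_bigr => j _.
by rewrite ff ?gg //; apply: leq_ltn_trans iN; rewrite ?leq_subr // -ltnS.
Qed.
Lemma eqmMl N f g h : eqm N g h -> eqm N (f * g) (f * h).
Proof. exact: eqmM. Qed.
Lemma eqmMr N f g h : eqm N g h -> eqm N (g * f) (h * f).
Proof. by move=> ?; apply: eqmM. Qed.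
Lemma eqm_sum N I (r : seq I) (P : pred I) (F G : I -> fps R) :
  (forall i, P i -> eqm N (F i) (G i)) ->
  eqm N (\sum_(i <- r | P i) F i) (\sum_(i <- r | P i) G i).
Proof. by move=> FG; elim/big_rec2: _ => // i f g Pi; apply: eqmD; apply: FG. Qed.
Lemma eqmXn N k f g : eqm N f g -> eqm (k + N) (qX R ^+ k * f) (qX R ^+ k * g).
Proof.
by case=> fg; split=> i iN; rewrite !coefXnM; case: leqP => // ki; apply: fg; lia.
Qed.
Lemma eqmXn0 N k f : (N <= k)%N -> eqm N (qX R ^+ k * f) 0.
Proof. by move=> Nk; split=> i iN; rewrite coefXnM ifF //; lia. Qed.
Lemma eqm_eq f g : (forall N, eqm N f g) -> f = g.
Proof. by move=> fg; apply: fpsE => i; apply: (eqm_coef (fg i.+1)). Qed.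

Lemma fps_mulfI (u f g : fps R) : u 0%N = 1 -> u * f = u * g -> f = g.
Proof.
move=> u0 ufg; apply: fpsE => n; elim/ltn_ind: n => n IHn.
have /(congr1 (fun h : fps R => h n)) := ufg.
rewrite !coefME !big_nat_recl //= !subn0 u0 !mul1r !big_mkord.
under eq_bigr => i _ do rewrite IHn ?ltn_subrL ?(leq_ltn_trans _ (ltn_ord i)) //.
exact: addIr.
Qed.

Lemma qXnI k f g : qX R ^+ k * f = qX R ^+ k * g -> f = g.
Proof.
move=> fg; apply: fpsE => n.
have := congr1 (fun h : fps R => h (n + k)%N) fg.
by rewrite /= !coefXnM leq_addl addnK.
Qed.

Lemma coef0M f g : (f * g) 0%N = f 0%N * g 0%N.
Proof. by rewrite coefME big_nat1. Qed.

Definition geo (k : nat) : fps R := fun n => (k %| n)%N%:R.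

Lemma geoK k : (0 < k)%N -> (1 - qX R ^+ k) * geo k = 1.
Proof.
move=> k0; rewrite mulrBl mul1r; apply: fpsE => n.
rewrite coefDE coefNE coefXnM coef1E /geo; case: leqP => kn; last first.
  case: n kn => [|n] kn; first by rewrite dvdn0 subr0.
  by rewrite gtnNdvd // subr0.
by rewrite dvdn_subl ?dvdnn // subrr; case: n kn => [|n] //; lia.
Qed.

(** The series 1/(q^b;q^b)_n, the concrete [E] for Q = q^b. *)
Definition geo_prod (b n : nat) : fps R := \prod_(j < n) geo (b * j.+1).

Lemma geo_prod0 b : geo_prod b 0 = 1. Proof. exact: big_ord0. Qed.

Lemma geo_prodS b n : (0 < b)%N ->
  geo_prod b n = geo_prod b n.+1 * (1 - (qX R ^+ b) ^+ n.+1).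
Proof.
move=> b0; rewrite /geo_prod big_ord_recr /= -mulrA -exprM [geo _ * _]mulrC.
by rewrite geoK ?mulr1 // muln_gt0 b0.
Qed.

End Truncation.
Arguments eqm_trans {R N} g {f h}.

Section Bailey.
Variables (R : comNzRingType) (b : nat).
Hypothesis b0 : (0 < b)%N.
Let Q : fps R := qX R ^+ b.
Let E := geo_prod R b.
Let ES n : E n = E n.+1 * (1 - Q ^+ n.+1). Proof. exact: geo_prodS. Qed.

(** The convention 1/(Q;Q)_m = 0 for m < 0, which truncated subtraction alone would break. *)
Definition lower_geo (n r : nat) : fps R := if (r <= n)%N then E (n - r) else 0.
Let L := lower_geo.

(** The weight (-1;Q)_n Q^(n(n+1)/2); for Q = q^2 it is the numerator in the n-th term of the series
    of s. *)
Definition bailey_wt (n : nat) : fps R := (\prod_(j < n) (1 + Q ^+ j)) * Q ^+ 'C(n.+1, 2).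
Let M := bailey_wt.

Let MS n : M n.+1 = M n * (1 + Q ^+ n) * Q ^+ n.+1.
Proof. by rewrite /M /bailey_wt big_ord_recr /= (bin2S n.+1) exprD; ring. Qed.

(** The right side is a factor free of n times [h n - h n.+1], where h n =
    [M n * L n r.+1 * E (n + r)], so it telescopes in n. *)
Lemma bailey_cert n r :
  (1 + Q ^+ r.+1) * (M n * L n r.+1 * E (n + r.+1))
    - Q ^+ r.+1 * (1 + Q ^+ r) * (M n * L n r * E (n + r))
  = (1 - Q ^+ (2 * r).+1)
      * (M n * L n r.+1 * E (n + r) - M n.+1 * L n.+1 r.+1 * E (n.+1 + r)).
Proof.
rewrite MS /L /lower_geo ltnS subSS addSn addnS; case: (ltngtP r n) => [rn|//|->].
- have [d ->] : exists d, n = (r + d.+1)%N by exists (n - r).-1; lia.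
  have -> : (r + d.+1 - r.+1 = d)%N by lia.
  have -> : (r + d.+1 - r = d.+1)%N by lia.
  rewrite (ES d) (ES (r + d.+1 + r)).
  have -> : Q ^+ (r + d.+1 + r).+1 = Q ^+ r * Q ^+ r * Q ^+ d * Q * Q.
    by rewrite -!exprD -!exprSr; congr (Q ^+ _); lia.
  have -> : Q ^+ (r + d.+1).+1 = Q ^+ r * Q ^+ d * Q * Q.
    by rewrite -!exprD -!exprSr; congr (Q ^+ _); lia.
  have -> : Q ^+ (r + d.+1) = Q ^+ r * Q ^+ d * Q.
    by rewrite -!exprD -!exprSr; congr (Q ^+ _); lia.
  have -> : Q ^+ (2 * r).+1 = Q ^+ r * Q ^+ r * Q.
    by rewrite -!exprD -!exprSr; congr (Q ^+ _); lia.
  rewrite !exprSr; ring.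
- by rewrite !(mulr0, mul0r) !subr0 mulr0.
- rewrite subnn (ES (n + n)%N).
  rewrite (_ : (2 * n).+1 = (n + n).+1)%N; last by lia.
  by ring.
Qed.

Definition bailey_sum (K r : nat) : fps R := \sum_(n < K) M n * L n r * E (n + r).

Lemma bailey_sumS K r :
  eqm K ((1 + Q ^+ r.+1) * bailey_sum K r.+1) (Q ^+ r.+1 * (1 + Q ^+ r) * bailey_sum K r).
Proof.
suff: eqm K ((1 + Q ^+ r.+1) * bailey_sum K r.+1
           - Q ^+ r.+1 * (1 + Q ^+ r) * bailey_sum K r) 0.
  move=> /eqmD/(_ (eqm_refl K (Q ^+ r.+1 * (1 + Q ^+ r) * bailey_sum K r))).
  by rewrite subrK add0r.
pose h n := M n * L n r.+1 * E (n + r).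
rewrite /bailey_sum !mulr_sumr -sumrB.
under eq_bigr => n _ do rewrite bailey_cert.
rewrite -mulr_sumr -(big_mkord xpredT (fun n => h n - h n.+1)).
(* The lower end [h 0] vanishes by the convention in [lower_geo]. The upper end contains
   Q^(K(K+1)/2), hence vanishes modulo q^K. *)
have -> : \sum_(0 <= n < K) (h n - h n.+1) = - h K.
  elim: K => [|K IHK]; last by rewrite big_nat_recr //= IHK; ring.
  by rewrite big_nil /h /L /lower_geo /= mulr0 mul0r oppr0.
rewrite /h /M /bailey_wt -[Q ^+ 'C(_, _)]exprM.
have -> (x y z w u : fps R) : x * - (y * z * w * u) = z * (- x * y * w * u) by ring.
by apply: eqmXn0; rewrite bin2S; nia.
Qed.

(** Keeping the factor 1 + Q^r avoids division; its value 2 at r = 0 is the 2 on the right. *)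
Lemma bailey_sumE K r :
  eqm K ((1 + Q ^+ r) * bailey_sum K r) (2 * Q ^+ 'C(r.+1, 2) * bailey_sum K 0).
Proof.
elim: r => [|r IHr]; first by rewrite expr0 mulr1.
apply: (eqm_trans _ (bailey_sumS K r)); rewrite -mulrA.
apply: (eqm_trans _ (eqmMl _ IHr)); rewrite (bin2S r.+1) exprD.
have -> (x y z : fps R) : x * (2 * y * z) = 2 * (x * y) * z by ring.
exact: eqm_refl.
Qed.

(** The parenthesis is beta_n for alpha_0 = a_0 and alpha_r = a_r (1 + Q^r). The factor 1 + Q^r is
    exactly what [bailey_sumE] consumes once the two sums are exchanged. *)
Theorem bailey_lemma (a : nat -> fps R) K : (0 < K)%N ->
  eqm K (\sum_(n < K) M n * (a 0%N * (E n * E n)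
            + \sum_(r < n) a r.+1 * (1 + Q ^+ r.+1) * (E (n - r.+1) * E (n + r.+1))))
        (bailey_sum K 0 * (a 0%N + 2 * \sum_(r < K.-1) a r.+1 * Q ^+ 'C(r.+2, 2))).
Proof.
case: K => // K _; rewrite [K.+1.-1]/=.
pose c r := if r is r'.+1 then a r * (1 + Q ^+ r) else a 0%N.
have -> : \sum_(n < K.+1) M n * (a 0%N * (E n * E n)
            + \sum_(r < n) a r.+1 * (1 + Q ^+ r.+1) * (E (n - r.+1) * E (n + r.+1)))
   = \sum_(r < K.+1) c r * bailey_sum K.+1 r.
  rewrite /bailey_sum; under [RHS]eq_bigr => r _ do rewrite mulr_sumr.
  rewrite exchange_big /=; apply: eq_bigr => n _.
  rewrite big_ord_recl /= mulrDr; congr (_ + _).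
    by rewrite /L /lower_geo /= subn0 addn0; ring.
  rewrite (big_ord_widen K (fun r => a r.+1 * (1 + Q ^+ r.+1)
    * (E (n - r.+1) * E (n + r.+1)))); last by rewrite -ltnS.
  rewrite mulr_sumr big_mkcond; apply: eq_bigr => r _; rewrite /bump /= /L /lower_geo.
  rewrite add1n; case: ifP => rn; last by rewrite !(mulr0, mul0r).
  ring.
rewrite big_ord_recl /=.
have -> : bailey_sum K.+1 0 * (a 0%N + 2 * \sum_(r < K) a r.+1 * Q ^+ 'C(r.+2, 2))
   = a 0%N * bailey_sum K.+1 0
     + \sum_(r < K) a r.+1 * (2 * Q ^+ 'C(r.+2, 2) * bailey_sum K.+1 0).
  rewrite mulrDr mulrC; congr (_ + _); rewrite mulrA mulr_sumr.
  by apply: eq_bigr => r _; ring.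
apply: eqmD => //; apply: eqm_sum => r _; rewrite -mulrA; apply: eqmMl.
exact: bailey_sumE.
Qed.

End Bailey.

(** * The finite Jacobi triple product and the generating function of s *)

Lemma bin2D m n : 'C(m + n, 2) = ('C(m, 2) + 'C(n, 2) + m * n)%N.
Proof. by elim: n => [|n IHn]; rewrite ?addn0 ?muln0 ?addnS ?bin2S //; nia. Qed.

Lemma bin2_sqr n : (2 * 'C(n, 2) + n = n * n)%N.
Proof. by elim: n => [|n IHn] //; rewrite bin2S; nia. Qed.

(** At k = n + r and k = n - r, the exponent C(k,2) + n (2n - k) is C(n,2) + n^2, common to all
    terms, plus C(r,2) or C(r+1,2). *)
Lemma bin2_centered_pos n r : (r <= n)%N ->
  ('C(n + r, 2) + n * (n - r) = 'C(n, 2) + n * n + 'C(r, 2))%N.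
Proof.
move=> /subnK <-; rewrite addnK; move: (n - r)%N => d.
by rewrite (bin2D (d + r)); nia.
Qed.

Lemma bin2_centered_neg n r : (r <= n)%N ->
  ('C(n - r, 2) + n * (n + r) = 'C(n, 2) + n * n + 'C(r.+1, 2))%N.
Proof.
move=> /subnK <-; rewrite addnK; move: (n - r)%N => d.
by rewrite bin2D (bin2S r); have := bin2_sqr r; nia.
Qed.

Section JacobiTriple.
Variables (R : comNzRingType) (a b : nat).
Hypotheses (b0 : (0 < b)%N) (ab : (a <= b)%N).
Let q := qX R.
Let Q : fps R := q ^+ b.
Let E := geo_prod R b.
Let ES n : E n = E n.+1 * (1 - Q ^+ n.+1). Proof. exact: geo_prodS. Qed.

Definition qpoch (a b n : nat) : fps R := \prod_(j < n) (1 - q ^+ (a + b * j)).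

(* The exponents of the terms of index [r] and [- r] in the bilateral theta
   series of general term q^(a r + b r (r-1)/2); when [a <= b] the subtraction
   does not truncate. *)
Definition theta_pos (r : nat) : nat := a * r + b * 'C(r, 2).
Definition theta_neg (r : nat) : nat := b * 'C(r.+1, 2) - a * r.

Lemma theta_negE r : (theta_neg r + a * r = b * 'C(r.+1, 2))%N.
Proof. by rewrite subnK // bin2S mulnDr; nia. Qed.

Definition jtp_sum (n : nat) : fps R :=
  E n * E n + \sum_(r < n) (-1) ^+ r.+1 * (q ^+ theta_pos r.+1 + q ^+ theta_neg r.+1)
                            * (E (n - r.+1) * E (n + r.+1)).

Let common n : fps R := (-1) ^+ n * q ^+ (a * n + b * ('C(n, 2) + n * n)).

Lemma qbin_sum_centered n : qbin_sum Q E (q ^+ a) (Q ^+ n) (2 * n) = common n * jtp_sum n.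
Proof.
rewrite /qbin_sum.
rewrite (sum_centered n (fun k => (-1) ^+ k * Q ^+ 'C(k, 2) * (q ^+ a) ^+ k
  * (Q ^+ n) ^+ (2 * n - k) * (E k * E (2 * n - k)))) mulrDr mulr_sumr.
have Xeq (x y z t : nat) (u : fps R) :
    (b * x + a * y + b * z = t)%N -> (-1) ^+ y * Q ^+ x * (q ^+ a) ^+ y * Q ^+ z * u
       = (-1) ^+ y * q ^+ t * u.
  by move=> <-; rewrite /Q -!exprM !exprD; ring.
congr (_ + _).
  rewrite (_ : 2 * n - n = n)%N; last by lia.
  rewrite -[(Q ^+ n) ^+ _]exprM (@Xeq _ _ _ (a * n + b * ('C(n, 2) + n * n))%N) //; lia.
apply: eq_bigr => r _; rewrite -![(Q ^+ n) ^+ _]exprM.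
have -> : (2 * n - (n - r.+1) = n + r.+1)%N by have := ltn_ord r; lia.
have -> : (2 * n - (n + r.+1) = n - r.+1)%N by have := ltn_ord r; lia.
rewrite (@Xeq _ _ _ (a * n + b * ('C(n, 2) + n * n) + theta_pos r.+1)%N); last first.
  by rewrite /theta_pos; have := bin2_centered_pos (ltn_ord r); nia.
rewrite (@Xeq _ _ _ (a * n + b * ('C(n, 2) + n * n) + theta_neg r.+1)%N); last first.
  have rn := ltn_ord r; have := theta_negE r.+1.
  have an : (a * (n - r.+1) + a * r.+1 = a * n)%N by rewrite -mulnDr subnK.
  have := congr1 (muln b) (bin2_centered_neg rn); rewrite !mulnDr; lia.
have sgn : (-1) ^+ (n - r.+1) = (-1) ^+ (n + r.+1) :> fps R.
  by rewrite -signr_odd -[RHS]signr_odd oddB ?oddD.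
by rewrite sgn /common !exprD; ring.
Qed.

(** The factors with j < n give up -q^(a+bj) and, in reverse order, form (q^(b-a);Q)_n; those with j
    >= n give up Q^n and form (q^a;Q)_n. *)
Lemma qprod_centered n :
  \prod_(j < 2 * n) (Q ^+ n - q ^+ a * Q ^+ j)
    = common n * (qpoch a b n * qpoch (b - a) b n).
Proof.
rewrite mul2n -addnn big_split_ord /=.
have -> : \prod_(j < n) (Q ^+ n - q ^+ a * Q ^+ j)
     = (-1) ^+ n * q ^+ (a * n + b * 'C(n, 2)) * qpoch (b - a) b n.
  have -> : (-1) ^+ n * q ^+ (a * n + b * 'C(n, 2))
      = \prod_(j < n) - q ^+ (a + b * j) :> fps R.
    elim: n => [|n IHn]; first by rewrite big_ord0 bin0n !muln0 mulr1.
    rewrite big_ord_recr -IHn /= bin2S exprS mulrN mulN1r mulNr -mulrA -exprD.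
    by congr (- (_ * q ^+ _)); lia.
  rewrite /qpoch [X in _ = _ * X](reindex_inj rev_ord_inj) -big_split /=.
  apply: eq_bigr => j _; have jn := ltn_ord j.
  rewrite mulrBr mulr1 mulNr opprK /Q -!exprM -!exprD [RHS]addrC.
  by congr (q ^+ _ - q ^+ _); nia.
have -> : \prod_(j < n) (Q ^+ n - q ^+ a * Q ^+ (n + j)) = Q ^+ (n * n) * qpoch a b n.
  have -> : Q ^+ (n * n) = \prod_(j < n) Q ^+ n by rewrite prodr_const card_ord exprM.
  rewrite -big_split /=.
  by apply: eq_bigr => j _; rewrite mulrBr mulr1 !exprD -!exprM; ring.
by rewrite /common mulnDr addnA [q ^+ (_ + b * (n * n))]exprD /Q -exprM; ring.
Qed.

(** The q-binomial theorem at z = q^a, w = Q^n, m = 2n, read around the middle index; the common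
    signed monomial cancels. *)
Theorem finite_jacobi_triple n :
  qfact Q (2 * n) * jtp_sum n = qpoch a b n * qpoch (b - a) b n.
Proof.
have := qbinomial (geo_prod0 R b) ES (q ^+ a) (Q ^+ n) (2 * n).
rewrite qbin_sum_centered qprod_centered mulrCA /common -!mulrA.
by move=> /(can_inj (signrMK n)) /qXnI.
Qed.

End JacobiTriple.

Lemma mul_inv_unique (V : comNzRingType) (D D' d d' S P : V) :
  D * D' = 1 -> d * d' = 1 -> d * P = D -> D * S = P -> S = d'.
Proof.
move=> DD dd dP DS; have -> : S = D' * (D * S).
  by rewrite mulrA [D' * D]mulrC DD mul1r.
rewrite DS -[D']mulr1 -dd (_ : _ * P = d' * (d * P * D')); last by ring.
by rewrite dP DD mulr1.
Qed.

Section SlaterIdentity.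
Local Notation q := (qX int).
Local Notation Q := (q ^+ 2).
Local Notation E := (geo_prod int 2).

(** Gauss's sum times (q^2;q^2)_m is (-q;q)_m, and (q^2;q^2)_m = (q;q)_m (-q;q)_m. *)
Lemma gauss_sum_geo m : gauss_sum q E m = geo_prod int 1 m.
Proof.
have ES n : E n = E n.+1 * (1 - Q ^+ n.+1) by exact: geo_prodS.
have E1S n : geo_prod int 1 n = geo_prod int 1 n.+1 * (1 - q ^+ n.+1).
  by have := @geo_prodS int 1 n isT; rewrite expr1.
have split : qfact q m * \prod_(j < m) (1 + q ^+ j.+1) = qfact Q m.
  by rewrite -big_split; apply: eq_bigr => j _ /=; rewrite -exprM mulnC exprM; ring.
apply: mul_inv_unique split (gauss_sumE (geo_prod0 int 2) ES m).
  exact: mul_qfactE (geo_prod0 int 2) ES m.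
exact: mul_qfactE (geo_prod0 int 1) E1S m.
Qed.

(* [Sum_{a >= 1} (-1)^(e a) q^(k a^2)], so that [1 + 2 * theta_tail 0 3] is
   phi(q^3) and [1 + 2 * theta_tail 1 2] is phi(-q^2). *)
Definition theta_tail (e k : nat) : fps int :=
  fun n => \sum_(a < n) (if (k * a.+1 ^ 2 == n)%N then (-1) ^+ (e * a.+1) else 0).

Lemma coef_signM m (f : fps int) i : ((-1) ^+ m * f) i = (-1) ^+ m * f i.
Proof. by rewrite -signr_odd -[in RHS]signr_odd; case: odd; rewrite ?mulN1r ?mul1r. Qed.

Lemma theta_tail_trunc e k K : (0 < k)%N ->
  eqm K (theta_tail e k) (\sum_(r < K.-1) (-1) ^+ (e * r.+1) * q ^+ (k * r.+1 ^ 2)).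
Proof.
move=> k0; split=> i iK; rewrite coef_sumE /theta_tail.
rewrite (big_ord_widen K.-1 (fun a =>
  if (k * a.+1 ^ 2 == i)%N then (-1) ^+ (e * a.+1) else 0)); last by lia.
rewrite big_mkcond; apply: eq_bigr => a _; rewrite coef_signM coefXn eq_sym.
case: eqP => [->|_]; rewrite ?mulr0 ?mulr1 ?if_same //.
by rewrite ifT // (leq_trans _ (leq_pmull _ k0)) // expnS leq_pmulr.
Qed.

(** For n > 0 the product (1;Q)_n contains the factor 1 - 1, and (Q;Q)_(2n) is invertible. This is
    the unit Bailey pair. *)
Lemma jtp_sum_unit n : jtp_sum int 0 2 n = (n == 0%N)%:R.
Proof.
case: n => [|n]; first by rewrite /jtp_sum big_ord0 addr0 geo_prod0 mulr1.
have ES m : E m = E m.+1 * (1 - Q ^+ m.+1) by exact: geo_prodS.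
have := @finite_jacobi_triple int 0 2 isT isT n.+1.
rewrite /qpoch [X in _ = X * _]big_ord_recl /= expr0 subrr !mul0r.
move=> /(congr1 (fun f => E (2 * n.+1) * f)).
by rewrite mulrA [E _ * _]mulrC (mul_qfactE (geo_prod0 int 2) ES) mul1r mulr0.
Qed.

Definition s_trunc (K : nat) : fps int :=
  \sum_(n < K) bailey_wt int 2 n * geo_prod int 1 (2 * n).

(** Bailey's lemma for the Gauss pair: the exponent at -r exceeds the one at r by 2r, which supplies
    1 + Q^r, and 2r^2 - r + r(r+1) = 3r^2 produces phi(q^3). *)
Lemma s_trunc_theta K : (0 < K)%N ->
  eqm K (s_trunc K) (bailey_sum int 2 K 0 * (1 + 2 * theta_tail 0 3)).
Proof.
move=> K0; have := @bailey_lemma int 2 isT (fun r => q ^+ (2 * r ^ 2 - r)) K K0.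
have -> : \sum_(n < K) bailey_wt int 2 n * (q ^+ (2 * 0 ^ 2 - 0) * (E n * E n)
     + \sum_(r < n) q ^+ (2 * r.+1 ^ 2 - r.+1) * (1 + Q ^+ r.+1)
                     * (E (n - r.+1) * E (n + r.+1))) = s_trunc K.
  apply: eq_bigr => n _; rewrite -gauss_sum_geo /gauss_sum; congr (_ * _).
  rewrite (sum_centered n (fun k => q ^+ c2 (2 * k%:Z - (2 * n)%:Z)
    * (E k * E (2 * n - k)))).
  have -> : (2 * n - n = n)%N by lia.
  congr (q ^+ _ * _ + _); first by have := mul2c2 (2 * n%:Z - (2 * n)%:Z); nia.
  apply: eq_bigr => r _; have rn := ltn_ord r.
  have -> : (2 * n - (n - r.+1) = n + r.+1)%N by lia.
  have -> : (2 * n - (n + r.+1) = n - r.+1)%N by lia.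
  have -> : c2 (2 * (n + r.+1)%:Z - (2 * n)%:Z) = (2 * r.+1 ^ 2 - r.+1)%N.
    have := mul2c2 (2 * (n + r.+1)%:Z - (2 * n)%:Z).
    have -> : 2 * (n + r.+1)%:Z - (2 * n)%:Z = 2 * r.+1%:Z by lia.
    nia.
  have -> : c2 (2 * (n - r.+1)%:Z - (2 * n)%:Z) = (2 * r.+1 ^ 2 - r.+1 + 2 * r.+1)%N.
    have := mul2c2 (2 * (n - r.+1)%:Z - (2 * n)%:Z).
    have -> : 2 * (n - r.+1)%:Z - (2 * n)%:Z = - (2 * r.+1%:Z) by lia.
    nia.
  rewrite exprD exprM; ring.
move=> /eqm_trans; apply; apply: eqmMl; rewrite expr0.
apply: eqmD => //; apply: eqmMl; apply: eqm_sym.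
apply: (eqm_trans _ (theta_tail_trunc 0 K _)) => //.
rewrite (eq_bigr (fun r : 'I_K.-1 => q ^+ (2 * r.+1 ^ 2 - r.+1) * Q ^+ 'C(r.+2, 2))) // => r _.
rewrite mul0n expr0 mul1r -exprM -exprD; congr (q ^+ _).
by have := mul2bin2 r.+2; nia.
Qed.

(** Bailey's lemma for the unit pair a_r = (-1)^r Q^(r(r-1)/2); C(r,2) + C(r+1,2) = r^2 produces
    phi(-q^2). *)
Lemma bailey_sum_theta K : (0 < K)%N ->
  eqm K 1 (bailey_sum int 2 K 0 * (1 + 2 * theta_tail 1 2)).
Proof.
move=> K0.
have := @bailey_lemma int 2 isT (fun r => (-1) ^+ r * Q ^+ 'C(r, 2)) K K0.
have -> : \sum_(n < K) bailey_wt int 2 n * ((-1) ^+ 0 * Q ^+ 'C(0, 2) * (E n * E n)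
     + \sum_(r < n) (-1) ^+ r.+1 * Q ^+ 'C(r.+1, 2) * (1 + Q ^+ r.+1)
                     * (E (n - r.+1) * E (n + r.+1))) = 1.
  rewrite (eq_bigr (fun n : 'I_K => bailey_wt int 2 n * (val n == 0%N)%:R)); last first.
    move=> n _; rewrite -jtp_sum_unit /jtp_sum; congr (_ * (_ + _)).
      by rewrite !expr0 !mul1r.
    apply: eq_bigr => r _; rewrite /theta_pos /theta_neg mul0n subn0 add0n !exprM.
    by rewrite [in RHS](bin2S r.+1) exprD; ring.
  case: K K0 => // K _; rewrite big_ord_recl big1 => [|n _]; last by rewrite mulr0.
  by rewrite /bailey_wt big_ord0 addr0 !mulr1.
move=> /eqm_trans; apply; apply: eqmMl; rewrite !expr0 mulr1.
apply: eqmD => //; apply: eqmMl; apply: eqm_sym.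
apply: (eqm_trans _ (theta_tail_trunc 1 K _)) => //.
rewrite (eq_bigr (fun r : 'I_K.-1 =>
  (-1) ^+ r.+1 * Q ^+ 'C(r.+1, 2) * Q ^+ 'C(r.+2, 2))) // => r _.
rewrite mul1n -mulrA -!exprM -exprD; congr (_ * q ^+ _).
by have := mul2bin2 r.+2; have := mul2bin2 r.+1; nia.
Qed.

Lemma sprodE (I : Type) (F : I -> series) (r : seq I) :
  sprod [seq F i | i <- r] = \prod_(i <- r) (F i : fps int) :> fps int.
Proof. by elim: r => [|i r IHr]; rewrite ?big_nil ?big_cons //= IHr. Qed.

Lemma sprod_iota (F : nat -> series) (m : nat) :
  sprod [seq F j | j <- iota 0 m] = \prod_(j < m) (F j : fps int) :> fps int.
Proof. by rewrite sprodE -(big_mkord xpredT) /index_iota subn0. Qed.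

Lemma monom1E k : monom 1 k = q ^+ k :> fps int.
Proof. by apply: fpsE => i; rewrite coefXn /monom; case: eqP. Qed.

Lemma factor1E k : factor 1 k = 1 - q ^+ k :> fps int.
Proof. by apply: fpsE => i; rewrite /factor monom1E. Qed.

Lemma factorN1E k : factor (-1) k = 1 + q ^+ k :> fps int.
Proof.
apply: fpsE => i; rewrite /factor coefDE coefXn /monom.
by case: eqP; rewrite ?opprK ?oppr0.
Qed.

Lemma inv_factor1E k : inv_factor 1 k = geo int k :> fps int.
Proof. by apply: fpsE => i; rewrite /inv_factor /geo expr1n; case: ifP. Qed.

Lemma s_termE n :
  s_term n = bailey_wt int 2 n * geo_prod int 1 (2 * n) :> fps int.
Proof.
rewrite /s_term /qpoch_fin /inv_qpoch_fin !sprod_iota monom1E /bailey_wt.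
rewrite -[smul _ _]/(_ * (_ * _) : fps int) mulrA -exprM mul2bin2 mulnC.
rewrite (eq_bigr _ (fun j _ => factorN1E _)) (eq_bigr _ (fun j _ => inv_factor1E _)).
congr (_ * _ * _ : fps int).
by apply: eq_bigr => j _; rewrite add0n exprM.
Qed.

Lemma s_truncE K : eqm K s (s_trunc K).
Proof.
split=> N NK; rewrite /s /s_trunc coef_sumE big_mkord.
rewrite (big_ord_widen K (fun n => s_term n N)) // big_mkcond /=.
apply: eq_bigr => n _; case: ifP => [_|]; first by rewrite s_termE.
move=> /negbT; rewrite -leqNgt => Nn.
rewrite /bailey_wt [\prod_(_ < _) _ * _]mulrC -mulrA -exprM coefXnM ifF //.
by have := mul2bin2 n.+1; nia.
Qed.

(** Eliminates the unknown factor [bailey_sum int 2 K 0] between the two preceding evaluations. *)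
Theorem s_theta_quotient :
  (s : fps int) * (1 + 2 * theta_tail 1 2) = 1 + 2 * theta_tail 0 3.
Proof.
apply: eqm_eq => K; case: K => [|K]; first by split.
apply: (eqm_trans _ (eqmMr _ (s_truncE _))).
apply: (eqm_trans _ (eqmMr _ (s_trunc_theta _))) => //.
rewrite mulrAC -[X in eqm _ _ X]mul1r; apply: eqmMr; apply: eqm_sym.
exact: bailey_sum_theta.
Qed.

End SlaterIdentity.

(** * Infinite products and theta series modulo 2 *)

Section InfiniteProducts.
Variable R : comNzRingType.
Local Notation q := (qX R).

Lemma qfact_qpoch b n : qfact (q ^+ b) n = qpoch R b b n.
Proof. by apply: eq_bigr => j _; rewrite -exprM mulnS. Qed.

(** The quotient (Q;Q)_m / (Q;Q)_k has only factors 1 - q^(bj) with j > k. *)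
Lemma qfact_geo_eqm b k m : (0 < b)%N -> (k <= m)%N ->
  eqm k.+1 (qfact (q ^+ b) m * geo_prod R b k) 1.
Proof.
move=> b0; elim: m => [|m IHm] km.
  have -> : k = 0%N by lia.
  by rewrite /qfact big_ord0 mul1r geo_prod0.
case: (ltngtP k m.+1) km => // [lkm _|-> _]; last first.
  by rewrite (mul_qfactE (geo_prod0 R b)) // => n; apply: geo_prodS.
rewrite qfactS mulrAC -[X in eqm _ _ X]mulr1; apply: eqmM; first exact: IHm.
rewrite -[X in eqm _ _ X]subr0 -exprM -[q ^+ _]mulr1.
by split=> i ik; rewrite !coefDE !coefNE coefXnM ifF //; nia.
Qed.

Lemma theta_pos_ge a b r : (0 < a)%N -> (r <= theta_pos a b r)%N.
Proof. by move=> a0; rewrite /theta_pos; nia. Qed.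

Lemma theta_neg_ge a b r : (a < b)%N -> (r <= theta_neg a b r)%N.
Proof. by move=> ab; rewrite /theta_neg bin2S; nia. Qed.

Definition theta_trunc (a b n : nat) : fps R :=
  1 + \sum_(r < n) (-1) ^+ r.+1 * (q ^+ theta_pos a b r.+1 + q ^+ theta_neg a b r.+1).

(** After multiplication by (Q;Q)_n the term of index r carries a factor that is 1 modulo q^(n-r);
    its theta exponents are at least r, which makes up for the loss. *)
Lemma jacobi_triple_trunc a b n : (0 < a < b)%N ->
  eqm n (qpoch R a b n * qpoch R (b - a) b n * qpoch R b b n) (theta_trunc a b n).
Proof.
move=> /andP[a0 ab]; have b0 : (0 < b)%N by lia.
rewrite -finite_jacobi_triple ?(ltnW ab) // -qfact_qpoch /jtp_sum /theta_trunc.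
set D := qfact _; set E := geo_prod R b.
have -> : D (2 * n)%N * (E n * E n + \sum_(r < n) (-1) ^+ r.+1
     * (q ^+ theta_pos a b r.+1 + q ^+ theta_neg a b r.+1)
     * (E (n - r.+1)%N * E (n + r.+1)%N)) * D n
   = (D (2 * n)%N * E n) * (D n * E n) + \sum_(r < n) (-1) ^+ r.+1
     * (q ^+ theta_pos a b r.+1 + q ^+ theta_neg a b r.+1)
     * ((D (2 * n)%N * E (n + r.+1)%N) * (D n * E (n - r.+1)%N)).
  rewrite mulrDr mulrDl mulr_sumr mulr_suml; congr (_ + _); first by ring.
  by apply: eq_bigr => r _; ring.
apply: eqmD.
  rewrite -[X in eqm _ _ X]mulr1; apply: eqmM; apply: (@eqmW _ n.+1) => //.
    by apply: qfact_geo_eqm => //; lia.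
  exact: qfact_geo_eqm.
apply: eqm_sum => r _; have rn := ltn_ord r; rewrite -!mulrA; apply: eqmMl.
set Y := _ * (E _ * _).
have Y1 : eqm (n - r.+1) Y 1.
  rewrite /Y mulrA -[X in eqm _ _ X]mulr1; apply: eqmM.
    by apply: (@eqmW _ (n + r.+1).+1); [lia|apply: qfact_geo_eqm => //; lia].
  by apply: (@eqmW _ (n - r.+1).+1); [lia|apply: qfact_geo_eqm => //; lia].
rewrite mulrDl -[X in eqm _ _ (X + _)]mulr1 -[X in eqm _ _ (_ + X)]mulr1.
apply: eqmD; [move: (theta_pos_ge b r.+1 a0)|move: (theta_neg_ge r.+1 ab)] => ge.
  by apply: eqmW (eqmXn (theta_pos a b r.+1) Y1); lia.
by apply: eqmW (eqmXn (theta_neg a b r.+1) Y1); lia.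
Qed.

Definition pinf (a b : nat) : fps R := fun n => qpoch R a b n.+1 n.

Lemma pinf_eqm a b N M : (0 < b)%N -> (N <= M)%N -> eqm N (pinf a b) (qpoch R a b M).
Proof.
move=> b0 NM; split=> i iN; rewrite /pinf.
have: (i < M)%N by lia.
elim: M {NM} => // M IHM; rewrite ltnS leq_eqVlt => /orP[/eqP -> //|iM].
rewrite (IHM iM) /qpoch [in RHS]big_ord_recr /= mulrBr mulr1 [_ * q ^+ _]mulrC.
by rewrite coefDE coefNE coefXnM ifF ?subr0 //; nia.
Qed.

Lemma pinf0 a b : (0 < a)%N -> (0 < b)%N -> pinf a b 0%N = 1.
Proof.
move=> a0 b0; rewrite /pinf /qpoch big_ord1 coefDE coefNE coef1E coefXn muln0 addn0.
by case: a a0 => // a _; rewrite subr0.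
Qed.

Lemma qpoch_split k d n :
  qpoch R k k (d * n) = \prod_(j < d) qpoch R (k * j.+1) (k * d) n.
Proof.
elim: n => [|n IHn].
  by rewrite muln0 /qpoch big_ord0 big1 // => j _; rewrite big_ord0.
rewrite mulnSr /qpoch big_split_ord /= -/(qpoch R k k (d * n)) IHn -big_split /=.
apply: eq_bigr => j _; rewrite /qpoch big_ord_recr /=; congr (_ * (1 - q ^+ _)); nia.
Qed.

Lemma pinf_split k d : (0 < k)%N -> (0 < d)%N ->
  pinf k k = \prod_(j < d) pinf (k * j.+1) (k * d).
Proof.
move=> k0 d0; apply: eqm_eq => N; apply: (eqm_trans _ (pinf_eqm _ k0 (leq_pmull N d0))).
rewrite qpoch_split; elim/big_rec2: _ => // j f g _; apply: eqmM.
by apply: eqm_sym; apply: pinf_eqm => //; rewrite muln_gt0 k0.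
Qed.

Lemma jacobi_triple a b N : (0 < a < b)%N ->
  eqm N (pinf a b * pinf (b - a) b * pinf b b) (theta_trunc a b N).
Proof.
move=> ab; apply: (eqm_trans _ _ (jacobi_triple_trunc N ab)).
by apply: eqmM; [apply: eqmM|]; apply: pinf_eqm => //; lia.
Qed.

End InfiniteProducts.

(** * Theta series over F_2 as indicators of squares *)

Definition is_square (n : nat) : bool := [exists x : 'I_n.+1, x * x == n]%N.

Lemma is_squareP n : reflect (exists x, x * x = n)%N (is_square n).
Proof.
apply: (iffP existsP) => [[x /eqP <-]|[x xn]]; first by exists x.
have xle : (x < n.+1)%N by nia.
by exists (Ordinal xle); apply/eqP.
Qed.

Lemma sum_ord_eq (n y : nat) : (\sum_(r < n) (r == y :> nat) = (y < n))%N.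
Proof.
elim: n => [|n IHn]; first by rewrite big_ord0.
by rewrite big_ord_recr /= IHn ltnS; case: (ltngtP y n).
Qed.

Lemma mul_neq_addmul d a b : (2 < d)%N -> (d * a)%N <> (d * b + 2)%N.
Proof.
move=> d2 /(congr1 (modn^~ d)).
by rewrite /= modnMr mulnC modnMDl modn_small.
Qed.

(** As d > 2, the classes 1 and -1 modulo d are disjoint and x is hit exactly once: a theta
    coefficient becomes an indicator rather than an unknown parity. *)
Lemma count_pm1 d n x y : (2 < d)%N -> (y < n)%N ->
  x = (d * y + 1)%N \/ x = (d * y.+1 - 1)%N ->
  ((1 == x) + \sum_(r < n) ((d * r.+1 - 1 == x) + (d * r.+1 + 1 == x)) = 1)%N.
Proof.
move=> d2 yn [] ->; rewrite big_split /=.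
- rewrite [X in (_ + (X + _))%N]big1 => [|r _]; last first.
    apply/eqP; rewrite eqb0; apply/eqP => h.
    by apply: (@mul_neq_addmul d r.+1 y) => //; nia.
  case: y yn => [|y] yn.
    by rewrite muln0 big1 // => r _; apply/eqP; rewrite eqb0; nia.
  rewrite (eq_bigr (fun r : 'I_n => (r == y :> nat) : nat)) => [|r _].
    by rewrite sum_ord_eq (ltnW yn) (_ : 1 == _ = false)%N //; apply/eqP; nia.
  by congr nat_of_bool; rewrite eqn_add2r eqn_pmul2l ?eqSS; lia.
- rewrite [X in (_ + (_ + X))%N]big1 => [|r _]; last first.
    apply/eqP; rewrite eqb0; apply/eqP => h.
    by apply: (@mul_neq_addmul d y.+1 r.+1) => //; nia.
  rewrite (eq_bigr (fun r : 'I_n => (r == y :> nat) : nat)) => [|r _].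
    by rewrite sum_ord_eq yn (_ : 1 == _ = false)%N //; apply/eqP; nia.
  congr nat_of_bool; rewrite -[RHS]eqSS -(@eqn_pmul2l d); last by lia.
  by apply/eqP/eqP; nia.
Qed.

Local Notation F2s := (fps 'F_2).

Lemma pchar_F2s : 2 \in [pchar F2s].
Proof.
apply/andP; split=> //; apply/eqP; apply: fpsE => n.
by rewrite coefMnE (mulrn_pchar (pchar_Fp (isT : prime 2))).
Qed.

Lemma F2s_sign m : (-1) ^+ m = 1 :> F2s.
Proof. by rewrite (oppr_pchar2 pchar_F2s) expr1n. Qed.

(** The sum of q^(k(x^2-1)/c) over x^2 = 1 modulo c. Modulo 2, c = 24 is Euler's pentagonal series
    of ell_k and c = 8 is psi(q^k). *)
Definition theta_mod2 (c k : nat) : F2s :=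
  fun n => ((k %| n) && is_square (c * (n %/ k) + 1))%N%:R.

Lemma sqr_subn1 n : (0 < n)%N -> ((n - 1) * (n - 1) + 2 * n = n * n + 1)%N.
Proof. by case: n => // n _; rewrite subn1 /=; nia. Qed.

(** Completing the square, with c = d(d-2) and c b = 2d^2. *)
Lemma theta_exponent c d b r s : (c + 2 * d = d ^ 2)%N -> (c * b = 2 * d ^ 2)%N ->
  (0 < d)%N -> (0 < r)%N -> (s + r = b * 'C(r.+1, 2))%N ->
  (c * (r + b * 'C(r, 2)) + 1 = (d * r - 1) * (d * r - 1))%N
    /\ (c * s + 1 = (d * r + 1) * (d * r + 1))%N.
Proof.
move=> cd cb d0 r0; rewrite bin2S mulnDr => sr; have C1 := bin2_sqr r.
have E1 : (c * (b * 'C(r, 2)) + d * d * r = d * r * (d * r))%N.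
  rewrite mulnA cb; have -> : (d * r * (d * r) = d * d * (r * r))%N by ring.
  by rewrite -C1; ring.
have E2 : (c * r + 2 * (d * r) = d * d * r)%N by rewrite mulnA -mulnDl cd.
have E3 : (c * (b * r) = 2 * (d * d * r))%N by rewrite mulnA cb; ring.
have D0 : (0 < d * r)%N by rewrite muln_gt0 d0.
have E4 : (c * s + c * r = c * (b * r) + c * (b * 'C(r, 2)))%N.
  by rewrite -[LHS]mulnDr sr mulnDr.
set D := (d * r)%N in E1 E2 D0 *.
have DD := sqr_subn1 D0.
by split; [rewrite mulnDr|]; lia.
Qed.

(** Over F_2 the signs of the triple product disappear. The instances used are (c,d,b) = (24,6,3),
    (8,4,4) and (3,3,6). *)
Lemma theta_mod2_jacobi c d b k :
  (2 < d)%N -> (c + 2 * d = d ^ 2)%N -> (c * b = 2 * d ^ 2)%N -> (1 < b)%N -> (0 < k)%N ->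
  (forall x i, (x * x = c * i + 1)%N ->
     exists y, x = (d * y + 1)%N \/ x = (d * y.+1 - 1)%N) ->
  pinf 'F_2 k (k * b) * pinf 'F_2 (k * b - k) (k * b) * pinf 'F_2 (k * b) (k * b)
    = theta_mod2 c k.
Proof.
move=> d2 cd cb b1 k0 sq.
have c0 : (0 < c)%N.
  by rewrite lt0n; apply/eqP => c0; move: cb; rewrite c0; clear -d2; nia.
apply: eqm_eq => N.
apply: (eqm_trans _ (@jacobi_triple 'F_2 k (k * b) N _)); first by nia.
split=> i iN; rewrite /theta_trunc coefDE coef_sumE coef1E.
under eq_bigr => r _ do rewrite F2s_sign mul1r coefDE !coefXn -natrD.
rewrite -natr_sum -natrD; congr (_%:R); rewrite /theta_mod2.
have pE r : theta_pos k (k * b) r = (k * (r + b * 'C(r, 2)))%N by rewrite /theta_pos; nia.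
have [s sE] : exists s, forall r, (s r + r = b * 'C(r.+1, 2))%N.
  by exists (fun r => b * 'C(r.+1, 2) - r)%N => r; rewrite subnK // bin2S; nia.
have nE r : theta_neg k (k * b) r = (k * s r)%N by rewrite /theta_neg -mulnA -sE; nia.
under eq_bigr => r _ do rewrite pE nE.
case: (boolP (k %| i)%N) => [/dvdnP[j ij]|ki] /=; last first.
  have nk X : (i == k * X)%N = false.
    by apply: contraNF ki => /eqP ->; rewrite dvdn_mulr.
  by rewrite -{1}(muln0 k) nk big1 // => r _; rewrite !nk.
have jN : (j < N)%N by nia.
rewrite {}ij [(j * k)%N]mulnC mulKn // in iN *.
(* The constant term of the theta series plays the part of the root x = 1. *)
have -> : ((k * j == 0) = (1 * 1 == c * j + 1))%N by apply/eqP/eqP; nia.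
under eq_bigr => r _.
  have [eqp eqn] := theta_exponent cd cb (ltnW (ltnW d2)) (ltn0Sn r) (sE r.+1).
  have H1 : (k * j == k * (r.+1 + b * 'C(r.+1, 2)))%N
          = ((d * r.+1 - 1) * (d * r.+1 - 1) == c * j + 1)%N.
    by rewrite -eqp eqn_add2r !eqn_pmul2l // eq_sym.
  have H2 : (k * j == k * s r.+1)%N = ((d * r.+1 + 1) * (d * r.+1 + 1) == c * j + 1)%N.
    by rewrite -eqn eqn_add2r !eqn_pmul2l // eq_sym.
  rewrite H1 H2; over.
case: is_squareP => [[x xj]|nsq]; last first.
  have nn y : (y * y == c * j + 1)%N = false by apply/eqP => h; apply: nsq; exists y.
  by rewrite nn big1 // => r _; rewrite !nn.
have sqE y : (y * y == c * j + 1)%N = (y == x).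
  by rewrite -xj; apply/eqP/eqP => [|->//]; nia.
rewrite sqE; under eq_bigr => r _ do rewrite !sqE.
have [y yx] := sq _ _ xj; apply: (@count_pm1 d N x y) => //.
(* The truncated sum reaches the index y because y <= j < N. *)
have yj : (y <= j)%N.
  have cE z : (c * z + 2 * (d * z) = d * d * z)%N by rewrite mulnA -mulnDl cd.
  have dE z : (d * z * (d * z) = d * d * (z * z))%N by ring.
  have le z : (d * d * z <= d * d * (z * z))%N by rewrite leq_mul2l; nia.
  rewrite -(leq_pmul2l c0); case: yx => yx; rewrite {}yx in xj.
    have := cE y; have := dE y; have := le y; nia.
  have dy0 : (0 < d * y.+1)%N by rewrite muln_gt0 (ltnW (ltnW d2)).
  have := sqr_subn1 dy0; have := cE y.+1; have := dE y.+1; have := le y.+1.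
  have : (c * y <= c * y.+1)%N by rewrite leq_pmul2l.
  lia.
exact: leq_ltn_trans yj jN.
Qed.

(** A square root of 1 modulo c is one modulo d; for d = 6, 4, 3 a finite check leaves only 1 and
    -1. *)
Lemma square1_pm1 d c : (0 < d)%N -> (d %| c)%N ->
  all (fun r => (r * r %% d == 1 %% d) ==> ((r == 1) || (r == d.-1)))%N (iota 0 d) ->
  forall x i, (x * x = c * i + 1)%N ->
    exists y, x = (d * y + 1)%N \/ x = (d * y.+1 - 1)%N.
Proof.
move=> d0 /dvdnP[e ->] chk x i xi; exists (x %/ d)%N.
have /allP/(_ (x %% d)%N) := chk; rewrite mem_iota add0n ltn_mod d0 => /(_ isT).
have -> : ((x %% d) * (x %% d) %% d = 1 %% d)%N.
  by rewrite modnMm xi mulnAC modnMDl.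
rewrite eqxx /= => /orP[] /eqP r1; have := divn_eq x d; rewrite r1; [left|right]; lia.
Qed.

Definition ell_mod2 (k : nat) : F2s := pinf 'F_2 k k.
Local Notation l := ell_mod2.

Lemma ell_mod2_0 k : (0 < k)%N -> l k 0%N = 1.
Proof. by move=> k0; apply: pinf0. Qed.

(** Factor by factor, 1 - q^(2m) = (1 - q^m)^2 modulo 2. *)
Lemma ell_mod2_double k : (0 < k)%N -> l (2 * k) = l k ^+ 2.
Proof.
move=> k0; apply: eqm_eq => N; have k20 : (0 < 2 * k)%N by lia.
apply: (eqm_trans _ (pinf_eqm _ _ k20 (leqnn N))).
have lk := pinf_eqm 'F_2 k k0 (leqnn N); apply/eqm_sym.
apply: (eqm_trans _ (eqmM lk lk)).
rewrite -expr2 /qpoch -prodrXl (eq_bigr (fun j : 'I_N => 1 - qX 'F_2 ^+ (2 * k + 2 * k * j))).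
  exact: eqm_refl.
move=> j _; have -> : (2 * k + 2 * k * j = (k + k * j) * 2)%N by lia.
rewrite exprM (oppr_pchar2 pchar_F2s) sqrrD expr1n mul1r.
by rewrite mulr2n (addrr_pchar2 pchar_F2s) addr0 (oppr_pchar2 pchar_F2s).
Qed.

Lemma theta_mod2_ell k : (0 < k)%N -> theta_mod2 24 k = l k.
Proof.
move=> k0; rewrite -(@theta_mod2_jacobi 24 6 3 k) //; last exact: square1_pm1.
rewrite /l (@pinf_split 'F_2 k 3) // !big_ord_recr big_ord0 /= mul1r muln1.
by have -> : (k * 3 - k = k * 2)%N by lia.
Qed.

(** The triple product satisfies (q^k,q^(3k),q^(4k);q^(4k)) l_(2k) = l_k l_(4k); modulo 2 both sides
    are powers of l_k times the unknown, and l_k^2 cancels. *)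
Lemma theta_mod2_psi k : (0 < k)%N -> theta_mod2 8 k = l k ^+ 3.
Proof.
move=> k0; have k20 : (0 < 2 * k)%N by lia.
have : theta_mod2 8 k * l (2 * k) = l k * l (2 * (2 * k)).
  rewrite -(@theta_mod2_jacobi 8 4 4 k) //; last exact: square1_pm1.
  rewrite /l (@pinf_split 'F_2 k 4) // (@pinf_split 'F_2 (2 * k) 2) //.
  rewrite !big_ord_recr !big_ord0 /= !mul1r !muln1.
  have -> : (k * 4 - k = k * 3)%N by lia.
  have -> : (2 * k * 2 = k * 4)%N by lia.
  have -> : (2 * (2 * k) = k * 4)%N by lia.
  by rewrite [(2 * k)%N]mulnC; ring.
rewrite !ell_mod2_double // => h; apply: (@fps_mulfI _ (l k ^+ 2)).
  by rewrite expr2 coef0M ell_mod2_0 // mulr1.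
by rewrite mulrC h; ring.
Qed.

(** Sorting exponents modulo 6, (q^k,q^(5k),q^(6k);q^(6k)) l_(2k) l_(3k) = l_k l_(6k)^2. The right
    side is psi(q^(3k)) modulo 2, the source of psi(q^3) and psi(q^6) in the residues 11 and 19. *)
Lemma theta_mod2_quintic k : (0 < k)%N -> theta_mod2 3 k * l k = l (3 * k) ^+ 3.
Proof.
move=> k0; have [k20 k30] : (0 < 2 * k)%N /\ (0 < 3 * k)%N by lia.
have : theta_mod2 3 k * l (2 * k) * l (3 * k) = l k * l (2 * (3 * k)) ^+ 2.
  rewrite -(@theta_mod2_jacobi 3 3 6 k) //; last exact: square1_pm1.
  rewrite /l (@pinf_split 'F_2 k 6) // (@pinf_split 'F_2 (2 * k) 3) //.
  rewrite (@pinf_split 'F_2 (3 * k) 2) //.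
  rewrite !big_ord_recr !big_ord0 /= !mul1r !muln1.
  have -> : (k * 6 - k = k * 5)%N by lia.
  have -> : (2 * k * 3 = k * 6)%N by lia.
  have -> : (2 * k * 2 = k * 4)%N by lia.
  have -> : (3 * k * 2 = k * 6)%N by lia.
  have -> : (2 * (3 * k) = k * 6)%N by lia.
  by rewrite [(2 * k)%N]mulnC [(3 * k)%N]mulnC; ring.
rewrite !ell_mod2_double // => h; apply: (@fps_mulfI _ (l k * l (3 * k))).
  by rewrite coef0M !ell_mod2_0 // mulr1.
have -> : l k * l (3 * k) * (theta_mod2 3 k * l k)
   = theta_mod2 3 k * l k ^+ 2 * l (3 * k) by ring.
by rewrite h; ring.
Qed.

Definition red (f : fps int) : F2s := fun n => (f n)%:~R.

Lemma redM f g : red (f * g) = red f * red g.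
Proof.
apply: fpsE => n; rewrite /red !coefME rmorph_sum.
by apply: eq_bigr => i _; rewrite rmorphM.
Qed.

Lemma eqm_red N f g : eqm N f g -> eqm N (red f) (red g).
Proof. by case=> fg; split=> i iN; rewrite /red fg. Qed.

Lemma red_sum (F : nat -> fps int) n :
  red (\sum_(r < n) F r) = \sum_(r < n) red (F r).
Proof.
by apply: fpsE => i; rewrite /red !coef_sumE rmorph_sum.
Qed.

Lemma red_qX k : red (qX int ^+ k) = qX 'F_2 ^+ k.
Proof. by apply: fpsE => n; rewrite /red !coefXn; case: eqP. Qed.

Lemma red_qpoch a b n : red (qpoch int a b n) = qpoch 'F_2 a b n.
Proof.
rewrite /qpoch; elim: n => [|n IHn].
  by rewrite !big_ord0; apply: fpsE => i; rewrite /red !coef1E; case: eqP.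
rewrite !big_ord_recr /= redM IHn; congr (_ * _); apply: fpsE => i.
by rewrite /red !coefDE !coefNE !coef1E !coefXn rmorphB /=; do 2!case: eqP.
Qed.

Lemma red_ell k : red (ell k) = l k.
Proof.
apply: fpsE => n; rewrite /l /pinf -red_qpoch /red /ell /qpoch_inf; congr (_%:~R).
have -> : qpoch_fin 1 k k n.+1 = qpoch int k k n.+1 :> fps int; last by [].
rewrite /qpoch_fin sprod_iota; apply: eq_bigr => j _; exact: factor1E.
Qed.

Lemma red_psi k : (0 < k)%N -> red (psi_at k) = theta_mod2 8 k.
Proof.
move=> k0; apply: fpsE => n; rewrite /red /psi_at /theta_mod2 big_mkord.
rewrite (eq_bigr (fun m : 'I_n.+1 => (k * (m * m.+1)./2 == n)%N%:R)); last first.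
  by move=> m _; case: ifP.
have tri m : (8 * (m * m.+1)./2 + 1 = (2 * m + 1) * (2 * m + 1))%N.
  have : ~~ odd (m * m.+1) by rewrite oddM /= andbN.
  by move=> /even_halfK; nia.
rewrite -natr_sum mulrz_nat; congr (_%:R).
case: (boolP (k %| n)%N) => [/dvdnP[j nj]|kn] /=; last first.
  rewrite big1 // => m _; apply/eqP; rewrite eqb0.
  by apply: contra kn => /eqP <-; apply: dvdn_mulr.
have -> : (n %/ k = j)%N by rewrite nj mulnK.
have nE X : (k * X == n)%N = (X == j) by rewrite nj mulnC eqn_pmul2r.
case: is_squareP => [[x xj]|nsq]; last first.
  rewrite big1 // => m _; apply/eqP; rewrite eqb0 nE.
  by apply/eqP => mj; apply: nsq; exists (2 * m + 1)%N; rewrite -mj tri.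
have [y xy] : exists y, x = (2 * y + 1)%N.
  exists x./2; have : odd (x * x) by rewrite xj; lia.
  by rewrite oddM andbb => ox; lia.
rewrite (eq_bigr (fun m : 'I_n.+1 => (m == y :> nat) : nat)) ?sum_ord_eq.
  have yj : (y <= j)%N by nia.
  by have -> : (y < n.+1)%N by nia.
move=> m _; congr nat_of_bool; rewrite nE.
by have tm := tri m; rewrite xy in xj; apply/eqP/eqP; nia.
Qed.

Definition square_multiple (k n : nat) : bool := (k %| n)%N && is_square (n %/ k).

Lemma square_multipleP k n : (0 < k)%N ->
  reflect (exists x, n = k * (x * x))%N (square_multiple k n).
Proof.
move=> k0; apply: (iffP andP) => [[/dvdnP[j ->]]|[x ->]].
  by rewrite mulnK // => /is_squareP[x <-]; exists x; rewrite mulnC.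
by split; [exact: dvdn_mulr|rewrite mulKn //; apply/is_squareP; exists x].
Qed.

(** [theta_sq] keeps the square 0 and serves to count representations; [theta_sq_pos] drops it, as
    the theta tails do. *)
Definition theta_sq (k : nat) : F2s := fun n => (square_multiple k n)%:R.
Definition theta_sq_pos (k : nat) : F2s := fun n => ((0 < n)%N && square_multiple k n)%:R.

Lemma red_theta_tail e k : (0 < k)%N -> red (theta_tail e k) = theta_sq_pos k.
Proof.
move=> k0; apply: fpsE => n; rewrite /red /theta_tail /theta_sq_pos.
rewrite (_ : _%:~R = (\sum_(a < n) (k * a.+1 ^ 2 == n)%N)%:R :> 'F_2); last first.
  rewrite rmorph_sum natr_sum; apply: eq_bigr => a _; case: ifP => // _.
  by rewrite -signr_odd; case: odd; apply/val_inj.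
congr (_%:R); case: (posnP n) => [->|n0] /=; first by rewrite big_ord0.
case: square_multipleP => // [[x nx]|nsq]; last first.
  rewrite big1 // => a _; apply/eqP; rewrite eqb0; apply/eqP => na; apply: nsq.
  by exists a.+1; rewrite -[LHS]na mulnn.
case: x nx => [|x] nx; first by nia.
have nE X : (k * X == n)%N = (X == x.+1 * x.+1)%N by rewrite nx eqn_pmul2l.
rewrite (eq_bigr (fun a : 'I_n => (a == x :> nat) : nat)) ?sum_ord_eq.
  by have -> : (x < n)%N by nia.
move=> a _; congr nat_of_bool; rewrite nE.
by apply/eqP/eqP; nia.
Qed.

(** Squaring is additive in characteristic 2. This makes A^2 B a series of the binary form 4x^2 +
    3y^2. *)
Lemma theta_sq_pos_sqr k : (0 < k)%N -> theta_sq_pos k ^+ 2 = theta_sq_pos (2 * k).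
Proof.
have trunc m N : (0 < m)%N ->
    eqm N (theta_sq_pos m) (\sum_(r < N.-1) qX 'F_2 ^+ (m * r.+1 ^ 2)).
  move=> m0; have := eqm_red (theta_tail_trunc 0 N m0); rewrite red_theta_tail //.
  rewrite (red_sum (fun r => (-1) ^+ (0 * r.+1) * qX int ^+ (m * r.+1 ^ 2))).
  under eq_bigr => r _ do rewrite mul0n expr0 mul1r red_qX.
  by [].
move=> k0; apply: eqm_eq => N; rewrite expr2.
apply: (eqm_trans _ (eqmM (trunc k N k0) (trunc k N k0))); apply: eqm_sym.
apply: (eqm_trans _ (trunc (2 * k)%N N _)); first by lia.
rewrite -expr2 -[X in eqm _ _ X](pFrobenius_autE pchar_F2s) rmorph_sum.
rewrite (eq_bigr (fun r : 'I_N.-1 => pFrobenius_aut pchar_F2s (qX 'F_2 ^+ (k * r.+1 ^ 2)))).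
  exact: eqm_refl.
by move=> r _; rewrite pFrobenius_autE -exprM; congr (_ ^+ _); lia.
Qed.

(** * Arithmetic progressions and binary quadratic forms *)

Definition progression (R : Type) (d r : nat) (U : fps R) : fps R :=
  fun u => U (d * u + r)%N.

(** The support condition fixes the residue of i, so only the pairs d u + r1, d (m - u) + r2
    contribute. It is used modulo 24 and modulo p^2. *)
Lemma fps_mul_dissect (R : comNzRingType) (d r1 r2 m : nat) (U V : fps R) :
  (r1 < d)%N -> (r2 < d)%N ->
  (forall i j, (i + j = d * m + (r1 + r2))%N -> U i != 0 -> V j != 0 -> (i %% d = r1)%N) ->
  (U * V) (d * m + (r1 + r2))%N
    = (progression d r1 U * progression d r2 V) m.
Proof.
move=> r1d r2d supp; rewrite !coefME !big_mkord.
set N := (d * m + (r1 + r2))%N; pose F i := U i * V (N - i)%N.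
rewrite [RHS](eq_bigr (fun u : 'I_m.+1 => \sum_(i < N.+1 | i == (d * u + r1)%N :> nat) F i)).
  rewrite (exchange_big_dep xpredT) //=; apply: eq_bigr => i _; rewrite -/(F i).
  have [Fi0|Fi0] := eqVneq (F i) 0; first by rewrite Fi0 big1.
  have iN : (i <= N)%N by rewrite -ltnS.
  have Ui : U i != 0 by apply: contraNneq Fi0 => Ui; rewrite /F Ui mul0r.
  have Vi : V (N - i)%N != 0 by apply: contraNneq Fi0 => Vi; rewrite /F Vi mulr0.
  have ir : (i %% d = r1)%N by apply: (supp i (N - i)%N) => //; rewrite subnKC.
  have iE : (i : nat) = (d * (i %/ d) + r1)%N by rewrite -ir mulnC -divn_eq.
  have im : (i %/ d < m.+1)%N.
    rewrite ltnS leqNgt; apply/negP => mi.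
    have : (d * m.+1 <= d * (i %/ d))%N by rewrite leq_mul2l mi orbT.
    have : (d * (i %/ d) + r1 <= d * m + (r1 + r2))%N by rewrite -iE.
    by rewrite mulnS; move: (d * (i %/ d))%N (d * m)%N => A B; clear -r2d; lia.
  rewrite (eq_bigl (fun u : 'I_m.+1 => u == (i %/ d)%N :> nat)) => [|u].
    by rewrite (big_ord1_eq _ (fun=> F i)) im.
  by rewrite {1}iE eqn_add2r eqn_pmul2l ?(leq_ltn_trans _ r1d) // eq_sym.
move=> u _; have um : (u <= m)%N by rewrite -ltnS.
have dm : (d * u + d * (m - u) = d * m)%N by rewrite -mulnDr subnKC.
rewrite (big_ord1_eq _ F) ifT; last by rewrite /N; lia.
rewrite /F /progression /N -dm; congr (_ * V _).
by move: (d * u)%N (d * (m - u))%N => A B; lia.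
Qed.

(** Everything depends on x modulo 24k' only: k x^2 = r modulo 24k' says that 24k' divides 24u. *)
Lemma residue_check k r k' g : (0 < k')%N -> (g %| 24 * k')%N ->
  all (fun x => (k * (x * x) %% 24 == r %% 24) ==>
        ((g %| x) && (k * (x * x) %% (24 * k') == r %% (24 * k'))))%N (iota 0 (24 * k')) ->
  forall x u, (k * (x * x) = 24 * u + r)%N -> (g %| x)%N /\ (k' %| u)%N.
Proof.
move=> k0 gM chk x u xu; set M := (24 * k')%N in gM chk.
have M0 : (0 < M)%N by rewrite muln_gt0.
have /allP/(_ (x %% M)%N) := chk; rewrite mem_iota add0n ltn_mod M0 => /(_ isT).
have xM : (k * ((x %% M) * (x %% M)) = k * (x * x) %[mod M])%N.
  by rewrite -[LHS]modnMmr modnMm modnMmr.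
have x24 : (k * ((x %% M) * (x %% M)) = k * (x * x) %[mod 24])%N.
  by rewrite -(modn_dvdm _ (dvdn_mulr k' (dvdnn 24))) xM modn_dvdm // dvdn_mulr.
rewrite xM x24 xu mulnC modnMDl eqxx /= => /andP[gx xr]; split.
  by rewrite (divn_eq x M) dvdn_add // dvdn_mull.
move: xr; rewrite eqn_mod_dvd ?leq_addl // addnK mulnC /M dvdn_pmul2l //.
Qed.

(** With x = g z and u = k' w, the equation k x^2 = 24u + r becomes r z^2 = r (c w + 1). *)
Lemma square_multiple_progression k r c k' g :
  (0 < k)%N -> (0 < k')%N -> (0 < g)%N -> (k * (g * g) = r)%N -> (r * c = 24 * k')%N ->
  (forall x u, (k * (x * x) = 24 * u + r)%N -> (g %| x)%N /\ (k' %| u)%N) ->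
  forall u, square_multiple k (24 * u + r) = (k' %| u)%N && is_square (c * (u %/ k') + 1).
Proof.
move=> k0 k'0 g0 kgr rc chk u.
have r0 : (0 < r)%N by rewrite -kgr !muln_gt0 k0 g0.
apply/square_multipleP/andP => // [[x xu]|[/dvdnP[w ->]]].
  have [/dvdnP[z xz] /dvdnP[w uw]] := chk _ _ (esym xu); rewrite uw mulnK //.
  split; first exact: dvdn_mull.
  apply/is_squareP; exists z; apply/eqP; rewrite -(eqn_pmul2l r0); apply/eqP.
  rewrite mulnDr [(r * (c * w))%N]mulnA rc muln1; rewrite uw xz in xu.
  have -> : (24 * k' * w + r = 24 * (w * k') + r)%N by ring.
  by rewrite xu -kgr; ring.
rewrite mulnK // => /is_squareP[z zw]; exists (g * z)%N.
have -> : (k * (g * z * (g * z)) = k * (g * g) * (z * z))%N by ring.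
rewrite kgr zw mulnDr muln1 [(r * (c * w))%N]mulnA rc; ring.
Qed.

Section FormProgression.
Variables (k1 k2 r1 r2 c1 c2 k1' k2' g1 g2 : nat).

(* Ensures that [k x^2 = 24 u + r] if and only if [u = k' w], [x = g z] and
   [z^2 = c w + 1]; the divisibilities [g %| x] and [k' %| u] are read off the
   residues modulo [24 k']. *)
Definition progression_data k r c k' g :=
  [&& 0 < k, 0 < k', 0 < g, k * (g * g) == r, r * c == 24 * k', g %| 24 * k' &
    all (fun x => (k * (x * x) %% 24 == r %% 24) ==>
        ((g %| x) && (k * (x * x) %% (24 * k') == r %% (24 * k')))) (iota 0 (24 * k'))]%N.

(** The support condition of [fps_mul_dissect] as a finite check: the value of the form modulo 24
    determines its first term. *)
Definition split_residues :=
  all (fun x => all (fun y => ((k1 * (x * x) + k2 * (y * y)) %% 24 == (r1 + r2) %% 24)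
                      ==> (k1 * (x * x) %% 24 == r1)) (iota 0 24))%N (iota 0 24).

Lemma progression_dataP k r c k' g : progression_data k r c k' g ->
  forall u, square_multiple k (24 * u + r) = (k' %| u)%N && is_square (c * (u %/ k') + 1).
Proof.
case/and5P=> k0 k'0 g0 /eqP kg /and3P[/eqP rc gM chk].
by apply: (@square_multiple_progression k r c k' g) => //; apply: residue_check.
Qed.

Hypotheses (data1 : progression_data k1 r1 c1 k1' g1)
           (data2 : progression_data k2 r2 c2 k2' g2).
Hypotheses (r1_lt : (r1 < 24)%N) (r2_lt : (r2 < 24)%N) (split_res : split_residues).

Lemma split_residuesP x y m :
  (k1 * (x * x) + k2 * (y * y) = 24 * m + (r1 + r2))%N -> (k1 * (x * x) %% 24 = r1)%N.
Proof.
move=> xy; have red24 k z : (k * ((z %% 24) * (z %% 24)) = k * (z * z) %[mod 24])%N.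
  by rewrite -[LHS]modnMmr modnMm modnMmr.
have in24 z : (z %% 24 \in iota 0 24)%N by rewrite mem_iota add0n ltn_mod.
have /allP/(_ _ (in24 x))/allP/(_ _ (in24 y)) := split_res.
by rewrite -modnDm !red24 modnDm xy mulnC modnMDl eqxx => /eqP.
Qed.

(** The values of [U] and [V] at 0 are left free so that both [theta_sq] and [theta_sq_pos] qualify;
    r1 and r2 are positive, so neither progression meets 0. *)
Lemma theta_product_progression (U V : F2s) m :
  (forall i, (0 < i)%N -> U i = (square_multiple k1 i)%:R) ->
  (forall i, (0 < i)%N -> V i = (square_multiple k2 i)%:R) ->
  (U * V) (24 * m + (r1 + r2))%N = (theta_mod2 c1 k1' * theta_mod2 c2 k2') m.
Proof.
have [k10 k20] : (0 < k1)%N /\ (0 < k2)%N.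
  by have /andP[? _] := data1; have /andP[? _] := data2.
have [r10 r20] : (0 < r1)%N /\ (0 < r2)%N.
  split; [have /and5P[? ? ? /eqP <- _] := data1|have /and5P[? ? ? /eqP <- _] := data2];
  by rewrite !muln_gt0; apply/and3P.
move=> HU HV; rewrite fps_mul_dissect //; last first.
  have supp k (W : F2s) i : (0 < k)%N ->
      (forall i, (0 < i)%N -> W i = (square_multiple k i)%:R) -> W i != 0 ->
      exists x, i = (k * (x * x))%N.
    move=> k0 HW; case: i => [|i]; first by move=> _; exists 0%N; rewrite mul0n muln0.
    by rewrite HW //; case: square_multipleP => // -[x ->] _; exists x.
  move=> i j ij /(supp _ _ _ k10 HU)[x xi] /(supp _ _ _ k20 HV)[y yj].
  by rewrite xi; apply: (@split_residuesP x y m); rewrite -xi -yj.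
congr ((_ * _ : F2s) m); apply: fpsE => u; rewrite /progression.
  by rewrite HU ?addn_gt0 ?r10 ?orbT // (progression_dataP data1).
by rewrite HV ?addn_gt0 ?r20 ?orbT // (progression_dataP data2).
Qed.

End FormProgression.

(* The parity of the number of [x, y >= 0] with [k1 x^2 + k2 y^2 = n]. *)
Definition rep_mod2 (k1 k2 : nat) : F2s := theta_sq k1 * theta_sq k2.

Section InertPrime.
Variables (k1 k2 p : nat).
Hypotheses (k10 : (0 < k1)%N) (k20 : (0 < k2)%N) (p_pr : prime p).
Hypothesis inert : forall x y,
  (p %| k1 * (x * x) + k2 * (y * y))%N -> (p %| x)%N /\ (p %| y)%N.

Let p2_gt0 : (0 < p ^ 2)%N. Proof. by rewrite expn_gt0 prime_gt0. Qed.

Let theta_sq_p2 k u : (0 < k)%N -> (forall x, p %| k * (x * x) -> p %| x)%N ->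
  theta_sq k (p ^ 2 * u)%N = theta_sq k u.
Proof.
move=> k0 div; rewrite /theta_sq; congr ((nat_of_bool _)%:R).
apply/square_multipleP/square_multipleP => // -[x xu]; last first.
  by exists (p * x)%N; rewrite xu; ring.
have /dvdnP[z xz] : (p %| x)%N by apply: div; rewrite -xu -mulnA dvdn_mulr.
exists z; apply/eqP; rewrite -(eqn_pmul2l p2_gt0) xu xz; apply/eqP; ring.
Qed.

Let supp i j : theta_sq k1 i != 0 -> theta_sq k2 j != 0 -> (p %| i + j)%N ->
  (p ^ 2 %| i)%N /\ (p ^ 2 %| j)%N.
Proof.
rewrite /theta_sq; case: square_multipleP => // -[x ->] _.
case: square_multipleP => // -[y ->] _ /inert[/dvdnP[z ->] /dvdnP[w ->]].
split; apply/dvdnP; [exists (k1 * (z * z))%N|exists (k2 * (w * w))%N]; ring.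
Qed.

(** Dissection modulo p^2 with both residues 0: inertness confines the contributing exponents to
    multiples of p^2, and then x and y are divided by p. *)
Lemma rep_mod2_p2 m : rep_mod2 k1 k2 (p ^ 2 * m)%N = rep_mod2 k1 k2 m.
Proof.
have := @fps_mul_dissect 'F_2 (p ^ 2) 0 0 m (theta_sq k1) (theta_sq k2) p2_gt0 p2_gt0.
rewrite /rep_mod2 !addn0 => -> => [|i j ij Ui Vj]; last first.
  have [] := supp Ui Vj; last by move=> /eqP.
  by rewrite ij -mulnA dvdn_mulr.
congr ((_ * _ : F2s) m); apply: fpsE => u; rewrite /progression addn0 theta_sq_p2 // => x px.
  by have [] := @inert x 0; rewrite ?muln0 ?addn0.
by have [] := @inert 0 x; rewrite ?muln0 ?add0n.
Qed.

Lemma rep_mod2_exp a m : rep_mod2 k1 k2 (p ^ (2 * a) * m)%N = rep_mod2 k1 k2 m.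
Proof.
elim: a => [|a IHa]; first by rewrite muln0 mul1n.
by rewrite mulnS expnD -mulnA rep_mod2_p2.
Qed.

Lemma rep_mod2_p m : ~~ (p %| m)%N -> rep_mod2 k1 k2 (p * m)%N = 0.
Proof.
move=> pm; rewrite /rep_mod2 coefME big_mkord big1 // => i _.
have iN : (i <= p * m)%N by rewrite -ltnS.
have [->|Ui] := eqVneq (theta_sq k1 i) 0; first by rewrite mul0r.
have [->|Vj] := eqVneq (theta_sq k2 (p * m - i)%N) 0; first by rewrite mulr0.
have [] := supp Ui Vj; first by rewrite subnKC // dvdn_mulr.
move=> di dj; case/negP: pm; rewrite -(@dvdn_pmul2l p) ?prime_gt0 //.
by rewrite -(subnKC iN) mulnn dvdn_add.
Qed.

End InertPrime.

Lemma legendre_inert (c p : nat) : prime p -> legendre (- c%:Z) p = -1 ->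
  forall X Y, (p %| X * X + c * (Y * Y))%N -> (p %| X)%N /\ (p %| Y)%N.
Proof.
move=> p_pr leg X Y pXY.
have noroot w : ~~ (p %| w * w + c)%N.
  move: leg; rewrite /legendre; case: ifP => // _; case: ifP => // /negbT/existsPn nr _.
  have wp : (w %% p < p)%N by rewrite ltn_mod prime_gt0.
  apply: contra (nr (Ordinal wp)) => /= pw; rewrite opprK expr2 -PoszM -PoszD.
  by rewrite -[_ \in _]/(p %| w %% p * (w %% p) + c)%N /dvdn -modnDml modnMm modnDml.
have pY : (p %| Y)%N.
  (* Bezout gives a with a Y = -1 modulo p; then (a X)^2 + c = a^2 (X^2 + c Y^2) = 0 modulo p,
     against [noroot]. *)
  apply: contraT => npY; have [a _] := Bezoutl Y (prime_gt0 p_pr).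
  rewrite (eqP (_ : coprime p Y)) ?prime_coprime // => /dvdnP[t at1].
  have [s sE] := dvdnP pXY; case/negP: (noroot (a * X)%N).
  have atE : a%:Z * Y%:Z = t%:Z * p%:Z - 1 by lia.
  have sZ : X%:Z * X%:Z + c%:Z * (Y%:Z * Y%:Z) = s%:Z * p%:Z by rewrite -!PoszM -PoszD sE.
  suff : (p%:Z %| (a * X * (a * X) + c)%N%:Z)%Z by [].
  (* The quotient by p of a^2 s p - c ((t p - 1)^2 - 1). *)
  apply/dvdzP; exists (a%:Z * a%:Z * s%:Z - c%:Z * (t%:Z * t%:Z * p%:Z - 2 * t%:Z)).
  rewrite PoszD !PoszM.
  have -> : (a%:Z * a%:Z * s%:Z - c%:Z * (t%:Z * t%:Z * p%:Z - 2 * t%:Z)) * p%:Z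
    = a%:Z * a%:Z * (s%:Z * p%:Z) - c%:Z * ((t%:Z * p%:Z - 1) * (t%:Z * p%:Z - 1) - 1) by ring.
  by rewrite -sZ -atE; ring.
split=> //; move: pXY; rewrite dvdn_addl; last by rewrite !dvdn_mull.
by rewrite Euclid_dvdM // orbb.
Qed.

(** * The expansion of s modulo 16 *)

Lemma theta_tail_neq0 e k n : theta_tail e k n != 0 -> exists a, n = (k * (a * a))%N.
Proof.
apply: contraNP => nsq; apply/eqP; rewrite /theta_tail big1 // => a _.
by case: eqP => // na; case: nsq; exists a.+1; rewrite -[LHS]na mulnn.
Qed.

Lemma theta_tail_mul0 e1 e2 k1 k2 n :
  (forall x y, n <> k1 * (x * x) + k2 * (y * y))%N ->
  ((theta_tail e1 k1 : fps int) * theta_tail e2 k2) n = 0.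
Proof.
move=> nrep; rewrite coefME big_mkord big1 // => i _.
have iN : (i <= n)%N by rewrite -ltnS.
have [->|/theta_tail_neq0[x xi]] := eqVneq (theta_tail e1 k1 i) 0; first by rewrite mul0r.
have [->|/theta_tail_neq0[y yi]] := eqVneq (theta_tail e2 k2 (n - i)%N) 0.
  by rewrite mulr0.
by case: (nrep x y); rewrite -xi -yi subnKC.
Qed.

Definition even_fps (f : fps int) := forall n, odd n -> f n = 0.

Lemma even_fpsM f g : even_fps f -> even_fps g -> even_fps (f * g).
Proof.
move=> ef eg n on; rewrite coefME big_mkord big1 // => i _.
have iN : (i <= n)%N by rewrite -ltnS.
have [oi|ei] := boolP (odd i); first by rewrite ef ?mul0r.
by rewrite eg ?mulr0 // oddB // on (negbTE ei).
Qed.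

Local Notation A := (theta_tail 1 2).
Local Notation B := (theta_tail 0 3).

Lemma even_A : even_fps A.
Proof.
move=> n on; apply/eqP; apply: contraLR on => /theta_tail_neq0[a ->].
by rewrite oddM.
Qed.

(** Powers of A vanish at odd N and B vanishes off the multiples of 3, so below order 16 only the
    mixed terms -4AB + 8A^2 B survive. *)
Lemma s_mod16 N : odd N -> ~~ (3 %| N)%N ->
  exists t : int, s N = - (A * B) N *+ 4 + (A * A * B) N *+ 8 + t *+ 16.
Proof.
move=> oN N3.
have sE : (s : fps int) = 1 + B *+ 2 - A *+ 2 + (A * A) *+ 4 - (A * A * A) *+ 8
    - (A * B) *+ 4 + (A * A * B) *+ 8 + (A * A * A * A * (s : fps int) - A * A * A * B) *+ 16.
  (* Uses (1 + 2A)(1 - 2A + 4A^2 - 8A^3) = 1 - 16A^4; the remainder keeps s itself as cofactor. *)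
  transitivity ((s : fps int) * (1 + 2 * A) * (1 - 2 * A + 4 * A ^+ 2 - 8 * A ^+ 3)
     + 16 * A ^+ 4 * (s : fps int)); first by ring.
  by rewrite s_theta_quotient; ring.
have B0 : B N = 0.
  apply/eqP; apply: contraNT N3 => /theta_tail_neq0[a ->]; exact: dvdn_mulr.
have eA := even_A.
exists ((A * A * A * A * (s : fps int) - A * A * A * B : fps int) N).
rewrite {1}sE !(coefDE, coefNE, coefMnE) coef1E B0 (eA N) //.
rewrite (even_fpsM eA eA) // (even_fpsM (even_fpsM eA eA) eA) //.
have -> : (N == 0%N) = false by case: (N) oN.
rewrite !mul0rn !(oppr0, addr0, add0r). ring.
Qed.

Lemma F2_dvd2 (x : int) : x%:~R = 0 :> 'F_2 -> (2 %| x)%Z.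
Proof.
have nat_case n : n%:R = 0 :> 'F_2 -> (2 %| n)%N.
  by move=> n0; rewrite (dvdn_pcharf (pchar_Fp (isT : prime 2))) n0.
case: x => n.
  by rewrite -pmulrn => /nat_case.
rewrite NegzE mulrNz -pmulrn => /eqP; rewrite oppr_eq0 => /eqP/nat_case h.
by rewrite dvdzE abszN.
Qed.

(** * The residues 5, 7, 11 and 19 modulo 24 *)

Lemma F2_double (x y : int) : x%:~R = y%:~R :> 'F_2 -> exists z, x = y + 2 * z.
Proof.
move=> xy; have /dvdzP[z xyz] : (2 %| x - y)%Z by apply: F2_dvd2; rewrite intrB xy subrr.
by exists z; lia.
Qed.

Lemma s_mod8_red N (x : int) : odd N -> ~~ (3 %| N)%N ->
  red (A * B) N = x%:~R -> (s N == 4 * x %[mod 8])%Z.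
Proof.
move=> oN N3 /F2_double[z zE]; have [t ->] := s_mod16 oN N3.
rewrite zE eqz_mod_dvd; apply/dvdzP.
exists (- x - z + (A * A * B) N + 2 * t); ring.
Qed.

(** Modulo 16 the parity of (AB)_N would not control -4AB, so this coefficient is required to
    vanish; [AB_eq0] provides it. *)
Lemma s_mod16_red N (x : int) : odd N -> ~~ (3 %| N)%N -> (A * B) N = 0 ->
  red (A * A * B) N = x%:~R -> (s N == 8 * x %[mod 16])%Z.
Proof.
move=> oN N3 AB0 /F2_double[z zE]; have [t ->] := s_mod16 oN N3.
rewrite AB0 zE eqz_mod_dvd; apply/dvdzP.
exists (z + t); ring.
Qed.

Lemma theta_sq_posE k i : (0 < i)%N -> theta_sq_pos k i = (square_multiple k i)%:R.
Proof. by rewrite /theta_sq_pos => ->. Qed.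

Lemma red_AB : red (A * B) = theta_sq_pos 2 * theta_sq_pos 3.
Proof. by rewrite redM !red_theta_tail. Qed.

Lemma red_AAB : red (A * A * B) = theta_sq_pos 4 * theta_sq_pos 3.
Proof. by rewrite !redM !red_theta_tail // -expr2 theta_sq_pos_sqr. Qed.

Lemma ell2E : l 2 = l 1 ^+ 2. Proof. exact: (@ell_mod2_double 1). Qed.
Lemma ell4E : l 4 = l 1 ^+ 4.
Proof. by rewrite -[4%N]/(2 * 2)%N ell_mod2_double // ell2E -exprM. Qed.

(** 2x^2 = 24u + 2 means u = 2w and x^2 = 24w + 1. The other data are read alike; those with g = 2
    force x to be even. *)
Lemma progression_2_2 : progression_data 2 2 24 2 1.
Proof. by vm_compute. Qed.

Lemma progression_3_3 : progression_data 3 3 8 1 1.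
Proof. by vm_compute. Qed.

Lemma split_2_3_2_3 : split_residues 2 3 2 3.
Proof. by vm_compute. Qed.

Lemma progression_1_1 : progression_data 1 1 24 1 1.
Proof. by vm_compute. Qed.

Lemma progression_4_4 : progression_data 4 4 24 4 1.
Proof. by vm_compute. Qed.

Lemma split_1_4_1_4 : split_residues 1 4 1 4.
Proof. by vm_compute. Qed.

Lemma progression_2_8 : progression_data 2 8 3 1 2.
Proof. by vm_compute. Qed.

Lemma split_2_3_8_3 : split_residues 2 3 8 3.
Proof. by vm_compute. Qed.

Lemma progression_9_9 : progression_data 9 9 8 3 1.
Proof. by vm_compute. Qed.

Lemma split_2_9_2_9 : split_residues 2 9 2 9.
Proof. by vm_compute. Qed.

Lemma split_4_3_4_3 : split_residues 4 3 4 3.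
Proof. by vm_compute. Qed.

Lemma progression_6_6 : progression_data 6 6 8 2 1.
Proof. by vm_compute. Qed.

Lemma split_1_6_1_6 : split_residues 1 6 1 6.
Proof. by vm_compute. Qed.

Lemma progression_4_16 : progression_data 4 16 3 2 2.
Proof. by vm_compute. Qed.

Lemma split_4_3_16_3 : split_residues 4 3 16 3.
Proof. by vm_compute. Qed.

Lemma progression_18_18 : progression_data 18 18 8 6 1.
Proof. by vm_compute. Qed.

Lemma split_1_18_1_18 : split_residues 1 18 1 18.
Proof. by vm_compute. Qed.

(** AB arises from 2x^2 + 3y^2, but over F_2 the product l_2 l_1^3 equals l_1 l_4, which x^2 + 4y^2
    also yields in [rep_5]. The form changes here, and with it the condition on p; the other three
    residues follow the same pattern. *)
Lemma AB_5 m : red (A * B) (24 * m + 5)%N = (l 1 * l 4) m.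
Proof.
rewrite red_AB
  (theta_product_progression progression_2_2 progression_3_3 isT isT split_2_3_2_3) //;
  try exact: theta_sq_posE.
congr ((_ : F2s) m); rewrite theta_mod2_ell // theta_mod2_psi // ell2E ell4E; ring.
Qed.

Lemma rep_5 m : rep_mod2 1 4 (24 * m + 5)%N = (l 1 * l 4) m.
Proof.
by rewrite /rep_mod2
  (theta_product_progression progression_1_1 progression_4_4 isT isT split_1_4_1_4) // !theta_mod2_ell.
Qed.

Lemma AB_11 m : red (A * B) (24 * m + 11)%N = (l 2 * l 3 ^+ 3) m.
Proof.
rewrite red_AB
  (theta_product_progression progression_2_8 progression_3_3 isT isT split_2_3_8_3) //;
  try exact: theta_sq_posE.
congr ((_ : F2s) m); rewrite theta_mod2_psi // -(@theta_mod2_quintic 1) // ell2E; ring.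
Qed.

Lemma rep_11 m : rep_mod2 2 9 (24 * m + 11)%N = (l 2 * l 3 ^+ 3) m.
Proof.
rewrite /rep_mod2
  (theta_product_progression progression_2_2 progression_9_9 isT isT split_2_9_2_9) //.
by rewrite theta_mod2_ell // theta_mod2_psi.
Qed.

Lemma AAB_7 m : red (A * A * B) (24 * m + 7)%N = (l 1 * l 2 ^+ 3) m.
Proof.
rewrite red_AAB
  (theta_product_progression progression_4_4 progression_3_3 isT isT split_4_3_4_3) //;
  try exact: theta_sq_posE.
congr ((_ : F2s) m); rewrite theta_mod2_ell // theta_mod2_psi // ell2E ell4E; ring.
Qed.

Lemma rep_7 m : rep_mod2 1 6 (24 * m + 7)%N = (l 1 * l 2 ^+ 3) m.
Proof.
rewrite /rep_mod2
  (theta_product_progression progression_1_1 progression_6_6 isT isT split_1_6_1_6) //.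
by rewrite theta_mod2_ell // theta_mod2_psi.
Qed.

Lemma AAB_19 m : red (A * A * B) (24 * m + 19)%N = (l 1 * l 6 ^+ 3) m.
Proof.
rewrite red_AAB
  (theta_product_progression progression_4_16 progression_3_3 isT isT split_4_3_16_3) //;
  try exact: theta_sq_posE.
congr ((_ : F2s) m); rewrite theta_mod2_psi // -(@theta_mod2_quintic 2) // ell2E; ring.
Qed.

Lemma rep_19 m : rep_mod2 1 18 (24 * m + 19)%N = (l 1 * l 6 ^+ 3) m.
Proof.
rewrite /rep_mod2
  (theta_product_progression progression_1_1 progression_18_18 isT isT split_1_18_1_18) //.
by rewrite theta_mod2_ell // theta_mod2_psi.
Qed.

(** Modulo 3 the form 2x^2 + 3y^2 takes only the values 0 and 2, while 7 and 19 are 1. *)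
Lemma AB_eq0 r m : (r == 7) || (r == 19) -> (A * B) (24 * m + r)%N = 0.
Proof.
move=> r7; apply: theta_tail_mul0 => x y h.
have : (24 * m + r = 1 %[mod 3])%N.
  by rewrite -[24%N]/(3 * 8)%N -mulnA mulnC modnMDl; case/orP: r7 => /eqP ->.
rewrite h [(3 * _)%N]mulnC addnC modnMDl -modnMm -[in X in (_ * X)%N]modnMm.
by have := ltn_pmod x (isT : 0 < 3)%N; case: (x %% 3)%N => [|[|[|]]].
Qed.

(** * Congruence families along the powers of an inert prime *)

Section Family.
Variables (p k1 k2 r : nat) (e M : int) (g : series).
Hypotheses (p_pr : prime p) (p5 : (5 <= p)%N) (k10 : (0 < k1)%N) (k20 : (0 < k2)%N).
Hypothesis inert : forall x y,
  (p %| k1 * (x * x) + k2 * (y * y))%N -> (p %| x)%N /\ (p %| y)%N.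
Hypothesis s_rep : forall n x,
  rep_mod2 k1 k2 (24 * n + r)%N = x%:~R -> (s (24 * n + r) == e * x %[mod M])%Z.
Hypothesis g_rep : forall n, rep_mod2 k1 k2 (24 * n + r)%N = (g n)%:~R.

(** p is prime to 24 and every unit modulo 24 squares to 1. Multiplication by p^(2a) thus preserves
    the class of r modulo 24. *)
Lemma sqr_prime_mod24 : exists t, (p ^ 2 = 24 * t + 1)%N.
Proof.
have [q2 q3] : ~~ (2 %| p)%N /\ ~~ (3 %| p)%N by rewrite !dvdn_prime2 //; lia.
exists (p ^ 2 %/ 24)%N; rewrite {1}(divn_eq (p ^ 2) 24) mulnC; congr (_ + _)%N.
rewrite -mulnn -modnMm.
have r2 : ~~ (2 %| p %% 24)%N by rewrite /dvdn modn_dvdm.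
have r3 : ~~ (3 %| p %% 24)%N by rewrite /dvdn modn_dvdm.
have : all (fun x => ~~ (2 %| x) ==> ~~ (3 %| x) ==> (x * x %% 24 == 1))%N (iota 0 24) by [].
move=> /allP/(_ (p %% 24)%N); rewrite mem_iota add0n ltn_mod => /(_ isT).
by rewrite r2 r3 => /eqP.
Qed.

Lemma exp_prime_mod24 a : exists t, (p ^ (2 * a) = 24 * t + 1)%N.
Proof.
have [u pu] := sqr_prime_mod24; elim: a => [|a [t pt]]; first by exists 0%N.
by exists (24 * u * t + u + t)%N; rewrite mulnS expnD pu pt; ring.
Qed.

Lemma family_scong a :
  scong (fun n => s (24 * p ^ (2 * a) * n + r * p ^ (2 * a))%N) (fun n => e * g n) M.
Proof.
move=> n; have [t pt] := exp_prime_mod24 a.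
have NE : (24 * p ^ (2 * a) * n + r * p ^ (2 * a) = p ^ (2 * a) * (24 * n + r))%N by ring.
have NE' : (p ^ (2 * a) * (24 * n + r) = 24 * (24 * t * n + n + t * r) + r)%N.
  by rewrite pt; ring.
rewrite NE NE'; apply: s_rep; rewrite -NE' rep_mod2_exp //; exact: g_rep.
Qed.

Lemma family_dvd a j n : (1 <= j <= p - 1)%N ->
  (M %| s (24 * p ^ (2 * a + 2) * n + 24 * p ^ (2 * a + 1) * j + r * p ^ (2 * a + 2))%N)%Z.
Proof.
move=> /andP[j1 jp]; have [t pt] := exp_prime_mod24 a.+1.
have pt' : (p ^ (2 * a + 2) = 24 * t + 1)%N by rewrite -pt mulnSr.
set N := (_ + _)%N.
have NE : N = (24 * (p ^ (2 * a + 2) * n + p ^ (2 * a + 1) * j + r * t) + r)%N.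
  by rewrite /N pt'; ring.
(* The power of p in [N] is exactly p^(2a+1): the last factor is 24j modulo p, and p divides neither
   24 nor j. *)
have NE' : N = (p ^ (2 * a) * (p * (p * (24 * n + r) + 24 * j)))%N.
  by rewrite /N expnD expnD [(p ^ 2)%N]expnS expn1; ring.
have : (s N == e * 0 %[mod M])%Z.
  rewrite NE; apply: s_rep; rewrite -NE NE' rep_mod2_exp // rep_mod2_p //.
  rewrite (dvdn_addr _ (dvdn_mulr _ (dvdnn p))) Euclid_dvdM //; apply/norP; split.
    by rewrite -[24%N]/(2 * (2 * (2 * 3)))%N !Euclid_dvdM // !dvdn_prime2 //; lia.
  by apply/negP => /dvdn_leq; lia.
by rewrite mulr0 eqz_mod_dvd subr0.
Qed.

End Family.

Section InertForms.
Variable p : nat.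
Hypotheses (p_pr : prime p) (p5 : (5 <= p)%N).

Let dvd_small c X : (0 < c < 5)%N -> (p %| c * X)%N -> (p %| X)%N.
Proof. by move=> c5; rewrite Euclid_dvdM // gtnNdvd //; lia. Qed.

Lemma inert_1_4 : legendre (-1) p = -1 -> forall x y,
  (p %| 1 * (x * x) + 4 * (y * y))%N -> (p %| x)%N /\ (p %| y)%N.
Proof.
move=> leg x y pxy; have [|px py] := @legendre_inert 1 p p_pr leg x (2 * y)%N.
  by have -> : (x * x + 1 * (2 * y * (2 * y)) = 1 * (x * x) + 4 * (y * y))%N by ring.
by split=> //; apply: dvd_small py.
Qed.

(** 2(2x^2 + 9y^2) = (2x)^2 + 2(3y)^2, and p >= 5 allows 2 and 3 to be removed. *)
Lemma inert_2_9 : legendre (-2) p = -1 -> forall x y,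
  (p %| 2 * (x * x) + 9 * (y * y))%N -> (p %| x)%N /\ (p %| y)%N.
Proof.
move=> leg x y pxy; have [|px py] := @legendre_inert 2 p p_pr leg (2 * x)%N (3 * y)%N.
  have -> : (2 * x * (2 * x) + 2 * (3 * y * (3 * y))
             = 2 * (2 * (x * x) + 9 * (y * y)))%N by ring.
  exact: dvdn_mull.
by split; [apply: dvd_small px|apply: dvd_small py].
Qed.

Lemma inert_1 c : legendre (- c%:Z) p = -1 -> forall x y,
  (p %| 1 * (x * x) + c * (y * y))%N -> (p %| x)%N /\ (p %| y)%N.
Proof. by move=> leg x y; rewrite mul1n; apply: legendre_inert. Qed.

End InertForms.

Theorem theorem9 :
  (forall (p alpha : nat), prime p -> (5 <= p)%N -> legendre (-1) p = -1 ->
     scong (fun n => s (24 * p ^ (2 * alpha) * n + 5 * p ^ (2 * alpha))%N)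
           (fun n => 4 * smul (ell 1) (ell 4) n) 8
     /\ forall j n : nat, (1 <= j <= p - 1)%N ->
          (8 %| s (24 * p ^ (2 * alpha + 2) * n + 24 * p ^ (2 * alpha + 1) * j
                   + 5 * p ^ (2 * alpha + 2))%N)%Z)
  /\
  (forall (p alpha : nat), prime p -> (5 <= p)%N -> legendre (-2) p = -1 ->
     scong (fun n => s (24 * p ^ (2 * alpha) * n + 11 * p ^ (2 * alpha))%N)
           (fun n => 4 * smul (ell 2) (psi_at 3) n) 8
     /\ forall j n : nat, (1 <= j <= p - 1)%N ->
          (8 %| s (24 * p ^ (2 * alpha + 2) * n + 24 * p ^ (2 * alpha + 1) * j
                   + 11 * p ^ (2 * alpha + 2))%N)%Z)
  /\
  (forall (p alpha : nat), prime p -> (5 <= p)%N -> legendre (-6) p = -1 ->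
     scong (fun n => s (24 * p ^ (2 * alpha) * n + 7 * p ^ (2 * alpha))%N)
           (fun n => 8 * smul (ell 1) (psi_at 2) n) 16
     /\ forall j n : nat, (1 <= j <= p - 1)%N ->
          (16 %| s (24 * p ^ (2 * alpha + 2) * n + 24 * p ^ (2 * alpha + 1) * j
                   + 7 * p ^ (2 * alpha + 2))%N)%Z)
  /\
  (forall (p alpha : nat), prime p -> (5 <= p)%N -> legendre (-18) p = -1 ->
     scong (fun n => s (24 * p ^ (2 * alpha) * n + 19 * p ^ (2 * alpha))%N)
           (fun n => 8 * smul (ell 1) (psi_at 6) n) 16
     /\ forall j n : nat, (1 <= j <= p - 1)%N ->
          (16 %| s (24 * p ^ (2 * alpha + 2) * n + 24 * p ^ (2 * alpha + 1) * j
                   + 19 * p ^ (2 * alpha + 2))%N)%Z).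
Proof.
have odd24 r n : odd r -> odd (24 * n + r) by rewrite oddD oddM.
have div24 r n : ~~ (3 %| r)%N -> ~~ (3 %| 24 * n + r)%N.
  by rewrite dvdn_addr // -[24%N]/(3 * 8)%N -mulnA dvdn_mulr.
have red_mul (f g : series) n : (smul f g n)%:~R = (red f * red g) n.
  by rewrite -redM.
split; [|split; [|split]] => p alpha p_pr p5 leg.
- have inert := inert_1_4 p_pr p5 leg.
  have s_rep n x : rep_mod2 1 4 (24 * n + 5)%N = x%:~R ->
      (s (24 * n + 5)%N == 4 * x %[mod 8])%Z.
    by rewrite rep_5 -AB_5; apply: s_mod8_red; rewrite ?odd24 ?div24.
  have g_rep n : rep_mod2 1 4 (24 * n + 5)%N = (smul (ell 1) (ell 4) n)%:~R.
    by rewrite rep_5 red_mul !red_ell.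
  split=> [|j n]; first exact: (family_scong p_pr p5 _ _ inert s_rep g_rep).
  exact: (family_dvd p_pr p5 _ _ inert s_rep).
- have inert := inert_2_9 p_pr p5 leg.
  have s_rep n x : rep_mod2 2 9 (24 * n + 11)%N = x%:~R ->
      (s (24 * n + 11)%N == 4 * x %[mod 8])%Z.
    by rewrite rep_11 -AB_11; apply: s_mod8_red; rewrite ?odd24 ?div24.
  have g_rep n : rep_mod2 2 9 (24 * n + 11)%N = (smul (ell 2) (psi_at 3) n)%:~R.
    by rewrite rep_11 red_mul red_ell red_psi // theta_mod2_psi.
  split=> [|j n]; first exact: (family_scong p_pr p5 _ _ inert s_rep g_rep).
  exact: (family_dvd p_pr p5 _ _ inert s_rep).
- have inert := @inert_1 p p_pr 6 leg.
  have s_rep n x : rep_mod2 1 6 (24 * n + 7)%N = x%:~R ->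
      (s (24 * n + 7)%N == 8 * x %[mod 16])%Z.
    by rewrite rep_7 -AAB_7; apply: s_mod16_red; rewrite ?odd24 ?div24 ?AB_eq0.
  have g_rep n : rep_mod2 1 6 (24 * n + 7)%N = (smul (ell 1) (psi_at 2) n)%:~R.
    by rewrite rep_7 red_mul red_ell red_psi // theta_mod2_psi.
  split=> [|j n]; first exact: (family_scong p_pr p5 _ _ inert s_rep g_rep).
  exact: (family_dvd p_pr p5 _ _ inert s_rep).
- have inert := @inert_1 p p_pr 18 leg.
  have s_rep n x : rep_mod2 1 18 (24 * n + 19)%N = x%:~R ->
      (s (24 * n + 19)%N == 8 * x %[mod 16])%Z.
    by rewrite rep_19 -AAB_19; apply: s_mod16_red; rewrite ?odd24 ?div24 ?AB_eq0.
  have g_rep n : rep_mod2 1 18 (24 * n + 19)%N = (smul (ell 1) (psi_at 6) n)%:~R.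
    by rewrite rep_19 red_mul red_ell red_psi // theta_mod2_psi.
  split=> [|j n]; first exact: (family_scong p_pr p5 _ _ inert s_rep g_rep).
  exact: (family_dvd p_pr p5 _ _ inert s_rep).
Qed.
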